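(* Let $(\Omega,\mu)$ be a separable measure space and let $E,F$ be two separable Banach spaces. Let $\phi\in L^\infty_\sigma(\Omega;\Gamma_2(E,F^* ))$. Then there exist a separable Hilbert space $H$ and two functions $$\alpha\in L^\infty_\sigma(\Omega;B(E,H))\qquad\text{and}\qquad \beta\in L^\infty_\sigma(\Omega;B(F,H))$$ such that $\|\alpha\|_\infty\|\beta\|_\infty\le\|\phi\|_\infty$ and, for any $(x,y)\in E\times F$, $$\langle[\phi(t)](x),y\rangle=\langle[\alpha(t)](x),[\beta(t)](y)\rangle\qquad\text{for a.e. }t\in\Omega,$$ where the bracket on the left is the duality pairing of $F^*$ with $F$, and the bracket on the right is the bilinear pairing $\langle h,k\rangle=\sum_n h_nk_n$ on $H$, with $(h_n)_n,(k_n)_n$ the coordinates of $h,k$ in a fixed orthonormal basis of $H$ (i.e. the duality pairing after identifying $H$ linearly with its dual $H^*$).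
   Context: A measure space $(\Omega,\mu)$ is separable if $L^2(\Omega,\mu)$ is separable (it is then $\sigma$-finite). For Banach spaces $E,W$, $B(E,W)$ is the space of bounded linear operators, and $\Gamma_2(E,W)$ is the space of operators $u\colon E\to W$ which factor as $u=\beta\alpha$ with bounded $\alpha\colon E\to K$, $\beta\colon K\to W$, $K$ a Hilbert space, with norm $\gamma_2(u)=\inf\|\alpha\|\|\beta\|$ over all such factorizations. $\Gamma_2(E,F^* )$ is a dual space: it is isometrically the dual of the completion of $E\otimes F$ for the norm $\gamma_2^*(z)=\sup\{|\langle u,z\rangle|:\gamma_2(u)\le1\}$, where $\langle u,x\otimes y\rangle=\langle u(x),y\rangle$. Similarly $B(E,H)$ is the dual of the projective tensor product $E\hat\otimes H^*$ and $B(F,H)$ that of $F\hat\otimes H^*$. All these preduals are separable. For a separable Banach space $Z$ with dual $Z^*$, a function $\phi\colon\Omega\to Z^*$ is $w^*$-measurable if $t\mapsto\langle\phi(t),z\rangle$ is measurable for every $z\in Z$; then $t\mapsto\|\phi(t)\|$ is measurable. $L^\infty_\sigma(\Omega;Z^* )$ is the Banach space of $w^*$-measurable functions $\phi\colon\Omega\to Z^*$ with $\|\phi(\cdot)\|\in L^\infty(\Omega)$, modulo a.e. zero functions, with norm $\|\phi\|_\infty=\operatorname{ess\,sup}_t\|\phi(t)\|$ (for $\Gamma_2(E,F^* )$ the pointwise norm is $\gamma_2$). *)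

(* Defs.v *)
(* MathComp-Analysis; Banach spaces are complex: the scalars are R[i], where
   R : realType. *)
From HB Require Import structures.
From mathcomp Require Import all_boot all_order all_algebra.
From mathcomp Require Import sesquilinear complex.
From mathcomp Require Import all_classical all_reals all_analysis.

Set Implicit Arguments.
Unset Strict Implicit.
Unset Printing Implicit Defensive.
Import Order.TTheory GRing.Theory Num.Theory.
Import numFieldNormedType.Exports.

Local Open Scope classical_set_scope.
Local Open Scope ring_scope.

(* Norms in a normedModType R[i] take their values in R[i] (on the nonnegative
   real axis); [nrm] is the same number seen in R. *)
Definition nrm (R : realType) (V : normedModType R[i]) (v : V) : R :=
  complex.Re `|v|.

Definition separable (V : topologicalType) : Prop :=
  exists2 A : set V, countable A & dense A.

Section NormTheory.
Variables (R : realType).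

Lemma nrmE (V : normedModType R[i]) (v : V) : `|v| = (nrm v)%:C%C.
Proof.
have := normr_ge0 v; rewrite /nrm lecE /= => /andP[/eqP i0 _].
by case: `|v| i0 => a b /= ->.
Qed.

Lemma nrm_ge0 (V : normedModType R[i]) (v : V) : 0 <= nrm v.
Proof. by have := normr_ge0 v; rewrite nrmE lecR. Qed.

Lemma nrmD (V : normedModType R[i]) (u v : V) : nrm (u + v) <= nrm u + nrm v.
Proof. by have := ler_normD u v; rewrite !nrmE -rmorphD /= lecR. Qed.

Lemma nrmZ (V : normedModType R[i]) (a : R[i]) (v : V) :
  nrm (a *: v) = complex.Re `|a| * nrm v.
Proof.
rewrite {1}/nrm normrZ nrmE /real_complex_def.
by case: `|a| => x y /=; rewrite mulr0 subr0.
Qed.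

Lemma nrm0 (V : normedModType R[i]) : nrm (0 : V) = 0.
Proof. by rewrite /nrm normr0. Qed.

Lemma Re_norm_ge0 (a : R[i]) : 0 <= complex.Re `|a|.
Proof. by have := normr_ge0 a; rewrite lecE => /andP[]. Qed.

End NormTheory.

Section BoundedOperators.
Variables (R : realType) (E W : normedModType R[i]).

Definition bounded_linear (f : E -> W) : Prop :=
  [/\ forall a x y, f (a *: x + y) = a *: f x + f y
    & exists M : R, forall x, nrm (f x) <= M * nrm x].

Definition bounded_linear_pred : {pred E -> W} :=
  fun f => `[< bounded_linear f >].

Record bop : Type := Bop {
  bop_fun :> E -> W;
  bop_subproof : bounded_linear_pred bop_fun }.

HB.instance Definition _ := [isSub for bop_fun].
HB.instance Definition _ := [Choice of bop by <:].

Fact bounded_linear_submod_closed : submod_closed bounded_linear_pred.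
Proof.
split.
- apply/asboolP; split=> [a x y|].
    by rewrite /= scaler0 addr0.
  by exists 0 => x; rewrite mul0r nrm0.
- move=> a f g /asboolP[fl [M fM]] /asboolP[gl [N gN]].
  apply/asboolP; split=> [b x y|].
    rewrite !fctE fl gl !scalerDr !scalerA [a * b]mulrC -!addrA; congr (_ + _).
    by rewrite addrCA.
  exists (complex.Re `|a| * M + N) => x.
  rewrite !fctE (le_trans (nrmD _ _))// mulrDl lerD// nrmZ -mulrA.
  by rewrite ler_wpM2l ?Re_norm_ge0.
Qed.

HB.instance Definition _ :=
  GRing.isSubmodClosed.Build R[i] (E -> W) bounded_linear_pred
    bounded_linear_submod_closed.
HB.instance Definition _ := [SubChoice_isSubLmodule of bop by <:].

Definition opnorm (f : bop) : R :=
  sup [set r | exists2 x : E, nrm x <= 1 & r = nrm (f x)].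

Let opset (f : bop) : set R :=
  [set r | exists2 x : E, nrm x <= 1 & r = nrm (f x)].

Let opset_sup (f : bop) : has_sup (opset f).
Proof.
split; first by exists (nrm (f 0)), 0; rewrite ?nrm0.
have /asboolP[_ [M fM]] := bop_subproof f; exists `|M| => _ [x x1 ->].
rewrite (le_trans (fM x))// (le_trans (ler_wpM2r (nrm_ge0 x) (ler_norm M)))//.
by rewrite -[leRHS]mulr1 ler_wpM2l.
Qed.

Let le_opnorm1 (f : bop) (x : E) : nrm x <= 1 -> nrm (f x) <= opnorm f.
Proof. by move=> x1; apply: (ub_le_sup (opset_sup f).2); exists x. Qed.

Let opnorm_le (f : bop) (M : R) :
  (forall x, nrm x <= 1 -> nrm (f x) <= M) -> opnorm f <= M.
Proof.
by move=> fM; apply: (ge_sup (opset_sup f).1) => _ [x x1 ->]; exact: fM.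
Qed.

Lemma bop_linear (f : bop) a x y : f (a *: x + y) = a *: f x + f y.
Proof. by have /asboolP[fl _] := bop_subproof f; exact: fl. Qed.

Lemma bop0 (f : bop) : f 0 = 0.
Proof.
have := bop_linear f (-1) 0 0.
by rewrite scaler0 addr0 scaleN1r addNr.
Qed.

Lemma bopZ (f : bop) a x : f (a *: x) = a *: f x.
Proof. by have := bop_linear f a x 0; rewrite bop0 !addr0. Qed.

Lemma opnorm_ge0 (f : bop) : 0 <= opnorm f.
Proof.
by rewrite (le_trans (nrm_ge0 (f 0)))// le_opnorm1// nrm0 ler01.
Qed.

Lemma le_opnorm (f : bop) (x : E) : nrm (f x) <= opnorm f * nrm x.
Proof.
have [->|x0] := eqVneq x 0; first by rewrite bop0 !nrm0 mulr0.
have nx : 0 < nrm x.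
  by rewrite lt_def nrm_ge0 andbT; move: x0; rewrite -normr_eq0 nrmE fmorph_eq0.
have Rnx : complex.Re `|(nrm x)^-1%:C%C| = (nrm x)^-1.
  by rewrite ger0_norm// lecR invr_ge0 ltW.
have := @le_opnorm1 f ((nrm x)^-1%:C%C *: x).
rewrite bopZ !nrmZ Rnx mulVf ?gt_eqF// => /(_ (lexx _)).
by rewrite ler_pdivrMl// mulrC.
Qed.

Definition bop_norm (f : bop) : R[i] := (opnorm f)%:C%C.

Fact bop_normD (f g : bop) : bop_norm (f + g) <= bop_norm f + bop_norm g.
Proof.
rewrite /bop_norm -rmorphD lecR; apply: opnorm_le => x x1.
by rewrite (le_trans (nrmD _ _))// lerD// le_opnorm1.
Qed.

Fact bop_normZ (a : R[i]) (f : bop) : bop_norm (a *: f) = `|a| * bop_norm f.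
Proof.
have aE : `|a| = (complex.Re `|a|)%:C%C := nrmE (a : R[i]^o).
have ZE (b : R[i]) (g : bop) : opnorm (b *: g) <= complex.Re `|b| * opnorm g.
  apply: opnorm_le => x x1.
  by rewrite nrmZ ler_wpM2l ?Re_norm_ge0// le_opnorm1.
rewrite aE /bop_norm -rmorphM; congr (_%:C)%C; apply/eqP.
rewrite eq_le ZE andTb.
have [->|a0] := eqVneq a 0; first by rewrite normr0 mul0r opnorm_ge0.
have Ra : 0 < complex.Re `|a|.
  by rewrite lt_def Re_norm_ge0 andbT; move: a0; rewrite -normr_eq0 aE fmorph_eq0.
have := ZE a^-1 (a *: f); rewrite scalerA mulVf// scale1r.
have -> : complex.Re `|a^-1| = (complex.Re `|a|)^-1.
  by rewrite normfV aE -fmorphV.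
by rewrite -ler_pdivlMl// invrK.
Qed.

Fact bop_norm0_eq0 (f : bop) : bop_norm f = 0 -> f = 0.
Proof.
move/eqP; rewrite fmorph_eq0 => /eqP f0; apply/val_inj/funext => x.
apply/eqP; rewrite -normr_eq0 nrmE fmorph_eq0 eq_le nrm_ge0 andbT.
by rewrite (le_trans (le_opnorm f x))// f0 mul0r.
Qed.

HB.instance Definition _ := Lmodule_isNormed.Build R[i] bop
  bop_normD bop_normZ bop_norm0_eq0.

End BoundedOperators.

Definition dual (R : realType) (F : normedModType R[i]) : normedModType R[i] :=
  bop F (R[i]^o : normedModType R[i]).

Record hilbertType (R : realType) := HilbertType {
  hilbert_sort :> completeNormedModType R[i];
  hdot : {dot hilbert_sort for @Num.conj R[i]};
  hdotE : forall x : hilbert_sort, hdot x x = `|x| ^+ 2 }.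

Section HilbertBasis.
Variables (R : realType) (H : hilbertType R).

(* The basis is indexed by a set D of natural numbers, so that H may have
   finite dimension. *)
Definition orthonormal_basis (D : set nat) (e : nat -> H) : Prop :=
  (forall m n, D m -> D n -> hdot H (e m) (e n) = (m == n)%:R) /\
  (forall h : H,
     (fun N => \sum_(0 <= n < N | n \in D) hdot H h (e n) *: e n) @ \oo --> h).

(* hdot is conjugate-linear in its second argument; this pairing is linear in
   both. *)
Definition bilinear_pairing (D : set nat) (e : nat -> H) (h k : H) : R[i] :=
  limn (fun N => \sum_(0 <= n < N | n \in D)
                   hdot H h (e n) * hdot H k (e n) : R[i]^o).

End HilbertBasis.

Section Gamma2.
Variables (R : realType) (E W : normedModType R[i]).

Definition hilbert_factorizations (u : bop E W) : set R :=
  [set r | exists (K : hilbertType R) (a : bop E K) (b : bop K W),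
     (forall x, u x = b (a x)) /\ r = nrm a * nrm b].

Definition Gamma2 (u : bop E W) : Prop := hilbert_factorizations u !=set0.

(* By the convention inf set0 = 0, only meaningful when Gamma2 u holds. *)
Definition gamma2 (u : bop E W) : R := inf (hilbert_factorizations u).

End Gamma2.

(* An element of the algebraic tensor product E (x) G is represented by a
   finite sequence of pairs (x_k, y_k), standing for \sum_k x_k (x) y_k. *)
Section TensorProduct.
Variables (R : realType) (E G : normedModType R[i]).
Implicit Types s : seq (E * G).

Definition tensor_eval (V : lmodType R[i]) (b : E -> G -> V) s : V :=
  \sum_(p <- s) b p.1 p.2.

Definition tensor_eq s s' : Prop :=
  forall (V : lmodType R[i]) (b : {bilinear E -> G -> V}),
    tensor_eval b s = tensor_eval b s'.

Definition tensor_sub s s' : seq (E * G) := s ++ [seq (- p.1, p.2) | p <- s'].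

Definition projective_norm s : R :=
  inf [set r | exists2 s', tensor_eq s s' &
                 r = \sum_(p <- s') nrm p.1 * nrm p.2].

(* An element of the completion of (E (x) G, N), as a Cauchy sequence. *)
Definition tensor_cauchy (N : seq (E * G) -> R) (z : nat -> seq (E * G)) :=
  forall eps : R, 0 < eps -> exists n0, forall m n,
    (n0 <= m)%N -> (n0 <= n)%N -> N (tensor_sub (z m) (z n)) < eps.

End TensorProduct.

Definition gamma2_dual_norm (R : realType) (E F : normedModType R[i])
    (s : seq (E * F)) : R :=
  sup [set r | exists2 u : bop E (dual F), Gamma2 u /\ gamma2 u <= 1 &
                 r = complex.Re `|tensor_eval (fun x y => u x y : R[i]^o) s|].

Section LinftySigma.
Variables (R : realType) (d : measure_display) (T : measurableType d).
Variable mu : {measure set T -> \bar R}.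

Definition measurable_C (f : T -> R[i]) : Prop :=
  measurable_fun setT (fun t => complex.Re (f t)) /\
  measurable_fun setT (fun t => complex.Im (f t)).

Definition square_integrable (f : T -> R[i]) : Prop :=
  measurable_C f /\
  ('N[mu]_2%:E [(fun t => (complex.Re `|f t|)%:E)] < +oo)%E.

Definition separable_measure : Prop :=
  exists g : nat -> T -> R[i], (forall n, square_integrable (g n)) /\
    forall f, square_integrable f -> forall eps : R, 0 < eps ->
      exists n, ('N[mu]_2%:E [(fun t => (complex.Re `|f t - g n t|)%:E)] < eps%:E)%E.

(* w*-measurability with respect to the completion of (E (x) G, N), for the
   duality given on elementary tensors by x (x) y |-> pair (phi t) x y. *)
Definition wstar_measurable (E G : normedModType R[i])
    (N : seq (E * G) -> R) (X : Type) (pair : X -> E -> G -> R[i])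
    (phi : T -> X) : Prop :=
  forall z : nat -> seq (E * G), tensor_cauchy N z ->
    measurable_C (fun t =>
      limn (fun n => tensor_eval (fun x y => pair (phi t) x y : R[i]^o) (z n))).

(* Classes modulo a.e. equality are represented by functions. *)
Definition Linfty_sigma_Gamma2 (E F : normedModType R[i])
    (phi : T -> bop E (dual F)) : Prop :=
  [/\ forall t, Gamma2 (phi t),
      wstar_measurable (@gamma2_dual_norm R E F)
        (fun (u : bop E (dual F)) x y => u x y) phi
    & (fun t => gamma2 (phi t)) \in Lfun mu +oo].

(* B(E, H) as the dual of the projective tensor product of E and H^*. *)
Definition Linfty_sigma_B (E : normedModType R[i]) (H : hilbertType R)
    (alpha : T -> bop E H) : Prop :=
  wstar_measurable (@projective_norm R E (dual H))
    (fun (u : bop E H) x (k : dual H) => k (u x)) alpha /\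
  (fun t => nrm (alpha t)) \in Lfun mu +oo.

Definition Linfty_norm (f : T -> R) : \bar R := 'N[mu]_+oo [EFin \o f].

End LinftySigma.

(* Main.v *)
Require Import Defs.
From HB Require Import structures.
From mathcomp Require Import all_boot all_order all_algebra.
From mathcomp Require Import sesquilinear complex.
From mathcomp Require Import all_classical all_reals all_analysis.
From mathcomp Require Import measurable_realfun ess_sup_inf ring lra.
Import Order.TTheory GRing.Theory Num.Theory.
Import numFieldNormedType.Exports.
Local Open Scope classical_set_scope.
Local Open Scope ring_scope.
Set Implicit Arguments.
Unset Strict Implicit.
Unset Printing Implicit Defensive.

(** Let c be the essential supremum of gamma2 (phi t).  After setting phi to 0 on
    a null set, gamma2 (phi t) <= c for every t.

    The idea is to describe a factorization of an operator u : E -> F^* through a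
    Hilbert space by numbers subject to countably many closed conditions, and to
    choose these numbers measurably.  Fix dense sequences (x_i) in E and (y_j) in
    F.  If u = be al with al a contraction, Gram-Schmidt applied to the vectors
    al(x_i) gives an orthonormal system (e_n), which may contain zeros; put
    a_i(n) = (al(x_i), e_n) and b_j(n) = be(e_n)(y_j).  Then a is triangular, i.e.,
    a_i(n) = 0 for n > i, hence
      u(x_i)(y_j) = sum_(n <= i) a_i(n) b_j(n)
    is a finite sum, and Bessel's inequality ([bessel_functional]) bounds the l2
    norm of p a_i + a_j - a_k by the norm of p x_i + x_j - x_k for all complex
    rational p, and similarly for b with the constant ||be||
    ([gamma2_coordinates]).  Conversely, arrays a and b with these properties
    extend by density to bounded operators E -> l2 and F -> l2
    ([dense_extension]), and since the coordinates b_j(n) are linear in y_j, the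
    formula above is a bilinear pairing on l2, with no conjugation
    ([pairing_eq]).

    For phi t the infimum gamma2 (phi t) need not be attained a priori, so the
    conditions with the constant c are only known to have approximate solutions.
    But the unknowns are bounded and each condition is continuous in finitely
    many of them, so approximate solutions have cluster points, which are
    solutions.  A cluster point can be chosen measurably in t, coordinate after
    coordinate, as an infimum over a countable dense set of approximate
    solutions ([measurable_cluster_point], [measurable_selection]).  This yields
    arrays depending measurably on t ([measurable_factorization]), hence families
    alpha and beta of operators with ||alpha t|| <= 1 and ||beta t|| <= c for all
    t.  Their w*-measurability and that of their norms follow from that of the
    entries by countable limits ([Linfty_sigma_BP]). *)

(** * The modulus and the norm as real numbers *)

Section Complex.
Variable R : realType.
Local Notation C := (R[i]).
Implicit Types (z w : C) (a b : R).

Definition cabs z : R := complex.Re `|z|.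

Lemma cabsE z : `|z| = (cabs z)%:C%C.
Proof. exact: (nrmE (z : C^o)). Qed.

Lemma nrm_cabs (z : C^o) : nrm z = cabs z. Proof. by []. Qed.

Lemma cabs_ge0 z : 0 <= cabs z. Proof. exact: Re_norm_ge0. Qed.

Lemma cabsM z w : cabs (z * w) = cabs z * cabs w.
Proof.
by apply: complexI; rewrite rmorphM /= -!cabsE normrM.
Qed.

Lemma cabsD z w : cabs (z + w) <= cabs z + cabs w.
Proof. by rewrite -lecR rmorphD /= -!cabsE ler_normD. Qed.

Lemma cabs0 : cabs 0 = 0. Proof. by rewrite /cabs normr0. Qed.

Lemma cabsN z : cabs (- z) = cabs z. Proof. by rewrite /cabs normrN. Qed.

Lemma cabs_eq0 z : (cabs z == 0) = (z == 0).
Proof. by rewrite -[RHS]normr_eq0 cabsE -(inj_eq (@complexI R)). Qed.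

Lemma sqr_cabs z : cabs z ^+ 2 = complex.Re z ^+ 2 + complex.Im z ^+ 2.
Proof. by apply: complexI; rewrite rmorphXn /= -cabsE -add_Re2_Im2. Qed.

Lemma conj_real a : Num.conj (a%:C)%C = (a%:C)%C.
Proof. exact: conjc_real. Qed.

Lemma cabs_conj z : cabs (Num.conj z) = cabs z.
Proof. by rewrite /cabs norm_conjC. Qed.

Lemma mul_conjE z : z * Num.conj z = (cabs z ^+ 2)%:C%C.
Proof. by rewrite -normCK cabsE rmorphXn. Qed.

Lemma Re_le_cabs z : `|complex.Re z| <= cabs z.
Proof. by rewrite -lecR -cabsE normc_ge_Re. Qed.

Lemma Im_le_cabs z : `|complex.Im z| <= cabs z.
Proof.
rewrite -(@ler_pXn2r _ 2)// ?nnegrE ?cabs_ge0// sqr_cabs.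
by rewrite real_normK ?num_real// lerDr sqr_ge0.
Qed.

Lemma cabs_le z : cabs z <= `|complex.Re z| + `|complex.Im z|.
Proof.
rewrite -(@ler_pXn2r _ 2)// ?nnegrE ?cabs_ge0 ?addr_ge0// sqr_cabs sqrrD.
by rewrite !real_normK ?num_real// addrAC lerDl mulrn_wge0// mulr_ge0.
Qed.

Lemma cabs_real a : cabs a%:C%C = `|a|.
Proof.
apply/eqP; rewrite -(@eqrXn2 _ 2)// ?cabs_ge0// sqr_cabs /= expr0n addr0.
by rewrite real_normK ?num_real.
Qed.

End Complex.

Section NrmTopology.
Variable R : realType.
Local Notation C := (R[i]).
Variable V : normedModType C.

Lemma nrmN (v : V) : nrm (- v) = nrm v. Proof. by rewrite /nrm normrN. Qed.

Lemma nrmB (u v : V) : nrm (u - v) = nrm (v - u).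
Proof. by rewrite -nrmN opprB. Qed.

Lemma nrm_eq0 (v : V) : (nrm v == 0) = (v == 0).
Proof. by rewrite -[RHS]normr_eq0 nrmE -(inj_eq (@complexI R)). Qed.

Lemma nrm_triangle (w u v : V) : nrm (u - v) <= nrm (u - w) + nrm (w - v).
Proof. by have := nrmD (u - w) (w - v); rewrite addrA subrK. Qed.

Lemma nrm_dist (u v : V) : `|nrm u - nrm v| <= nrm (u - v).
Proof.
have := nrmD (u - v) v; have := nrmD (v - u) u; rewrite !subrK (nrmB v u).
by rewrite ler_norml; lra.
Qed.

(** Convergence in a normed space over R[i] only involves real radii: this
    reduces every limit below to estimates between real numbers. *)
Lemma cvg_nrmP {T : Type} (F : set_system T) {FF : Filter F} (f : T -> V) (l : V) :
  f @ F --> l <-> (forall e : R, 0 < e -> \forall x \near F, nrm (l - f x) < e).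
Proof.
split=> [/cvgrPdist_lt fl e e0|fl].
  have := fl e%:C%C; rewrite ltcR => /(_ e0); apply: filterS => x.
  by rewrite nrmE ltcR.
apply/cvgrPdist_lt => e; rewrite ltcE => /andP[/eqP i0 e0].
apply: filterS (fl _ e0) => x; rewrite nrmE.
by case: e {e0} i0 => a b /= ->; rewrite ltcR.
Qed.

Lemma cvg_nrm {T : Type} (F : set_system T) {FF : Filter F} (f : T -> V) (l : V) :
  f @ F --> l -> (fun x => nrm (f x)) @ F --> nrm l.
Proof.
move=> /cvg_nrmP fl; apply/cvgrPdist_lt => e /fl; apply: filterS => x.
exact/le_lt_trans/nrm_dist.
Qed.

Lemma nrm_ballE (x : V) (e : R) (y : V) : ball x e%:C%C y <-> nrm (x - y) < e.
Proof. by rewrite -ball_normE /ball_ /= nrmE ltcR. Qed.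

End NrmTopology.

Section CauchyNrm.
Variable R : realType.
Local Notation C := (R[i]).

Lemma inv_nat_lt (e : R) : 0 < e -> \forall n \near \oo, (n.+1)%:R^-1 < e.
Proof.
move=> e0; have := @cvg_harmonic R => /cvgrPdist_lt/(_ _ e0).
by apply: filterS => n; rewrite sub0r normrN ger0_norm// invr_ge0.
Qed.

Definition nrm_cauchy (V : normedModType C) (u : nat -> V) := forall e : R, 0 < e ->
  exists n0, forall m n, (n0 <= m)%N -> (n0 <= n)%N -> nrm (u m - u n) < e.

Lemma nrm_cauchy_cvg (V : completeNormedModType C) (u : nat -> V) :
  nrm_cauchy u -> cvgn u.
Proof.
move=> cu; apply/cauchy_cvgP/cauchy_exP => e.
rewrite ltcE => /andP[/eqP i0 /= e0].
have -> : e = (complex.Re e)%:C%C by case: e {e0} i0 => ? ? /= ->.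
have [n0 H] := cu _ e0; exists (u n0); exists n0 => // n /= n0n.
by apply/nrm_ballE/H.
Qed.

(** Completeness can be tested on sequences: a Cauchy filter contains a ball of
    radius 1/(n+1) for each n, and converges to the limit of the centers. *)
Lemma nrm_seq_complete (V : normedModType C) :
  (forall u : nat -> V, nrm_cauchy u -> cvgn u) ->
  forall F : set_system V, ProperFilter F -> cauchy F -> cvg F.
Proof.
move=> VC F FF /cauchyP cF.
have {cF} /choice[u uF] : forall n : nat, exists x : V,
    F [set y : V | nrm (x - y) < (n.+1)%:R^-1 :> R].
  move=> n; have [|x xF] := cF ((n.+1)%:R^-1)%:C%C; first by rewrite ltcR invr_gt0.
  by exists x; apply: filterS xF => y /nrm_ballE.
have uu m n : nrm (u m - u n) < (m.+1)%:R^-1 + (n.+1)%:R^-1.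
  have [x [/= ux uy]] := filter_ex (filterI (uF m) (uF n)).
  by rewrite (le_lt_trans (nrm_triangle x _ _))// ltrD// nrmB.
have /VC/cvg_ex[l /cvg_nrmP ul] : nrm_cauchy u.
  move=> e e0; have [n0 _ H] := inv_nat_lt (divr_gt0 e0 (ltr0Sn _ 1)).
  exists n0 => m n /H /= Hm /H /= Hn; rewrite (lt_trans (uu _ _))//.
  by rewrite [ltRHS]splitr ltrD.
apply/cvg_ex; exists l; apply/(@cvg_nrmP _ _ _ F _ id) => e e0.
have e2 : 0 < e / 2 by rewrite divr_gt0.
have [n [nl ne]] := filter_ex (filterI (ul _ e2) (inv_nat_lt e2)).
apply: filterS (uF n) => x /= unx.
rewrite (le_lt_trans (nrm_triangle (u n) _ _))// [ltRHS]splitr ltrD//.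
exact: lt_trans ne.
Qed.

End CauchyNrm.

Section ComplexTopology.
Variable R : realType.
Local Notation C := (R[i]).
Context {T : Type} (F : set_system T) {FF : Filter F}.

Lemma cvg_Re (f : T -> C^o) (l : C^o) : f @ F --> l ->
  (fun x => complex.Re (f x)) @ F --> complex.Re l.
Proof.
move=> /cvg_nrmP fl; apply/cvgrPdist_lt => e /fl; apply: filterS => x.
by apply: le_lt_trans; rewrite -raddfB Re_le_cabs.
Qed.

Lemma cvg_Im (f : T -> C^o) (l : C^o) : f @ F --> l ->
  (fun x => complex.Im (f x)) @ F --> complex.Im l.
Proof.
move=> /cvg_nrmP fl; apply/cvgrPdist_lt => e /fl; apply: filterS => x.
by apply: le_lt_trans; rewrite -raddfB Im_le_cabs.
Qed.

Lemma cvg_conj (f : T -> C^o) (l : C^o) : f @ F --> l ->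
  (fun x => Num.conj (f x) : C^o) @ F --> (Num.conj l : C^o).
Proof.
move=> /cvg_nrmP fl; apply/cvg_nrmP => e /fl; apply: filterS => x.
by rewrite -rmorphB !nrm_cabs cabs_conj.
Qed.

Lemma cvg_complex (f : T -> C^o) (a b : R) :
  (fun x => complex.Re (f x)) @ F --> a ->
  (fun x => complex.Im (f x)) @ F --> b -> f @ F --> ((a +i* b)%C : C^o).
Proof.
move=> /cvgrPdist_lt fa /cvgrPdist_lt fb; apply/cvg_nrmP => e e0.
have e2 : 0 < e / 2 by rewrite divr_gt0.
apply: filterS2 (fa _ e2) (fb _ e2) => x xa xb.
apply: le_lt_trans (cabs_le _) _; rewrite [ltRHS]splitr ltrD//.
- by move: xa; rewrite /=; case: (f x).
- by move: xb; rewrite /=; case: (f x).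
Qed.

End ComplexTopology.

Section ComplexComplete.
Variable R : realType.
Local Notation C := (R[i]).

Lemma C_cauchy_cvg (u : nat -> C^o) : nrm_cauchy u -> cvgn u.
Proof.
move=> cu.
have H (p : C -> R) : (forall z w, p (z - w) = p z - p w) ->
    (forall z, `|p z| <= cabs z) -> cvgn (p \o u).
  move=> pB pc; apply/cauchy_cvgP/cauchy_exP => e e0.
  have [n0 H] := cu _ e0; exists (p (u n0)); exists n0 => // n /= n0n.
  by rewrite -ball_normE /ball_ /= -pB; exact/(le_lt_trans (pc _))/H.
have /cvg_ex[a ua] := H (@complex.Re R) (fun z w => raddfB _ z w) (@Re_le_cabs _).
have /cvg_ex[b ub] := H (@complex.Im R) (fun z w => raddfB _ z w) (@Im_le_cabs _).
by apply/cvg_ex; exists ((a +i* b)%C : C^o); exact: cvg_complex.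
Qed.

End ComplexComplete.

(** * Inner products and Gram-Schmidt *)

Section DotProduct.
Variables (R : realType).
Local Notation C := (R[i]).
Variables (V : lmodType C) (B : {dot V for @Num.conj C}).

Lemma dot_Re (u : V) : B u u = (complex.Re (B u u))%:C%C.
Proof. by rewrite RRe_real ?ger0_real ?dnorm_ge0. Qed.

Lemma dotC (u v : V) : B u v = Num.conj (B v u).
Proof. by rewrite hermC expr0 mul1r. Qed.

Lemma dotDl (u v w : V) : B (u + v) w = B u w + B v w.
Proof. exact: linearDl. Qed.

Lemma dotZl a (u w : V) : B (a *: u) w = a * B u w.
Proof. exact: linearZl_LR. Qed.

Lemma dotDr (u v w : V) : B w (u + v) = B w u + B w v.
Proof. exact: linearDr. Qed.

Lemma dotZr a (u w : V) : B w (a *: u) = Num.conj a * B w u.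
Proof. exact: linearZr_LR. Qed.

Lemma dotBl (u v w : V) : B (u - v) w = B u w - B v w.
Proof. exact: linearBl. Qed.

Lemma dotBr (u v w : V) : B w (u - v) = B w u - B w v.
Proof. exact: linearBr. Qed.

Lemma dot_suml (I : Type) (r : seq I) (P : pred I) (f : I -> V) (w : V) :
  B (\sum_(i <- r | P i) f i) w = \sum_(i <- r | P i) B (f i) w.
Proof. exact: linear_sumlz. Qed.

Lemma dot_sumr (I : Type) (r : seq I) (P : pred I) (f : I -> V) (w : V) :
  B w (\sum_(i <- r | P i) f i) = \sum_(i <- r | P i) B w (f i).
Proof. exact: linear_sumr. Qed.

Lemma dot_cauchy_schwarz (u v : V) :
  cabs (B u v) ^+ 2 <= complex.Re (B u u) * complex.Re (B v v).
Proof.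
have [->|v0] := eqVneq v 0.
  by rewrite !linear0r cabs0 expr0n.
have vv : 0 < complex.Re (B v v) by rewrite -ltcR -dot_Re dnorm_gt0.
set s := complex.Re (B v v) in vv *.
(* the component of u orthogonal to v, scaled by s to avoid a division *)
have := dnorm_ge0 B (s%:C%C *: u - B u v *: v).
have zz := mul_conjE (B u v).
rewrite !(dotBl, dotBr, dotZl, dotZr) (dotC v u) (dot_Re v) (dot_Re u) -/s.
have -> : Num.conj s%:C%C = s%:C%C by rewrite conj_real.
set z := B u v in zz *; set zc := Num.conj z in zz *.
set a := complex.Re (B u u).
rewrite (_ : _ - _ = s%:C%C * (s%:C%C * a%:C%C - z * zc)); last by ring.
rewrite zz -!rmorphM -rmorphB -rmorphM /= ler0c pmulr_rge0// subr_ge0.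
by rewrite mulrC.
Qed.

End DotProduct.

Section GramSchmidt.
Variable R : realType.
Local Notation C := (R[i]).
Variables (V : lmodType C) (B : {dot V for @Num.conj C}).

Definition unit_or_zero (x : V) := x = 0 \/ B x x = 1.

(** As 0^-1 = 0, this is 0 when r = 0. *)
Definition normalize (r : V) : V := (Num.sqrt (complex.Re (B r r)))^-1%:C%C *: r.

Lemma normalizeP r :
  unit_or_zero (normalize r) /\ r = B r (normalize r) *: normalize r.
Proof.
rewrite /unit_or_zero /normalize; have [->|r0] := eqVneq r 0.
  by rewrite !scaler0; split; [left|].
have rr : 0 < complex.Re (B r r) by rewrite -ltcR -dot_Re dnorm_gt0.
have E : (Num.sqrt (complex.Re (B r r)))^-1%:C%C *
    (Num.sqrt (complex.Re (B r r)))^-1%:C%C * B r r = 1.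
  rewrite [X in _ * X = _]dot_Re -!rmorphM -expr2 exprVn sqr_sqrtr ?ltW//.
  by rewrite mulVf ?gt_eqF.
split.
  by right; rewrite dotZl dotZr conj_real mulrA E.
by rewrite dotZr conj_real scalerA mulrAC E scale1r.
Qed.

(** Zero vectors are allowed, so that Gram-Schmidt applies to families that are
    not linearly independent and keeps their indexing. *)
Definition ortho_system (e : nat -> V) :=
  (forall m n, m != n -> B (e m) (e n) = 0) /\ (forall n, unit_or_zero (e n)).

(** The expansion of v_i stops at the index i: in the coordinates (v_i, e_n) the
    family v becomes a triangular array. *)
Lemma gram_schmidt (v : nat -> V) : exists2 e : nat -> V, ortho_system e &
  forall i, v i = \sum_(0 <= n < i.+1) B (v i) (e n) *: e n.
Proof.
pose fix gs n : seq V := if n is n'.+1 then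
  rcons (gs n') (normalize (v n' - \sum_(x <- gs n') B (v n') x *: x)) else [::].
pose e n := nth 0 (gs n.+1) n.
have szgs n : size (gs n) = n by elim: n => //= n IH; rewrite size_rcons IH.
have gsE n : gs n = mkseq e n.
  elim: n => // n IH; rewrite mkseqS -IH /e /=; congr rcons.
  by rewrite nth_rcons szgs ltnn eqxx.
(* r n is the component of v n orthogonal to the previous e k *)
pose r n := v n - \sum_(0 <= k < n) B (v n) (e k) *: e k.
have eE n : e n = normalize (r n).
  rewrite {1}/e /= nth_rcons szgs ltnn eqxx gsE /r; congr (normalize (_ - _)).
  by rewrite big_map /index_iota subn0.
have e01 n : unit_or_zero (e n) by rewrite eE; have [] := normalizeP (r n).
have orth n k : (k < n)%N -> B (e n) (e k) = 0.
  elim/ltn_ind: n k => n IH k kn.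
  rewrite eE /normalize dotZl; suff -> : B (r n) (e k) = 0 by rewrite mulr0.
  rewrite /r dotBl dot_suml big_mkord (bigD1 (Ordinal kn))//= big1 ?addr0.
    rewrite dotZl; case: (e01 k) => ->; last by rewrite mulr1 subrr.
    by rewrite !linear0r ?mulr0 ?subr0.
  move=> l lk; rewrite dotZl.
  have {}lk : (l != k :> nat) := lk.
  have [llk|kl] := ltnP l k.
    by rewrite [B (e l) _]dotC (IH k)// conjC0 mulr0.
  by rewrite (IH l) ?mulr0// ltn_neqAle eq_sym lk.
exists e.
  split=> // m n; rewrite neq_ltn => /orP[mn|nm]; last exact: orth.
  by rewrite dotC orth// conjC0.
move=> i; rewrite big_nat_recr//=.
suff <- : r i = B (v i) (e i) *: e i by rewrite /r addrC subrK.
have -> : B (v i) (e i) = B (r i) (e i).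
  rewrite /r dotBl dot_suml big_nat big1 ?subr0// => k /andP[_ ki].
  by rewrite dotZl [B (e k) _]dotC orth// conjC0 mulr0.
by rewrite eE; have [] := normalizeP (r i).
Qed.

(** Bessel's inequality for a bounded functional f: evaluate f at the sum of the
    conj (f e_n) e_n, where its value is the sum S of the |f e_n|^2, while the
    square of the norm of that vector is at most S. *)
Lemma bessel_functional (e : nat -> V) (f : V -> C) (M : R) : ortho_system e ->
  (forall a x y, f (a *: x + y) = a * f x + f y) ->
  0 <= M -> (forall x, cabs (f x) ^+ 2 <= M * complex.Re (B x x)) ->
  forall N, \sum_(0 <= n < N) cabs (f (e n)) ^+ 2 <= M.
Proof.
move=> [oe ue] fl M0 fM N.
pose S := \sum_(0 <= n < N) cabs (f (e n)) ^+ 2.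
pose h := \sum_(0 <= n < N) Num.conj (f (e n)) *: e n.
have f0 : f 0 = 0.
  have := fl 1 0 0; rewrite scaler0 addr0 mul1r => /eqP.
  by rewrite -subr_eq subrr eq_sym => /eqP.
have fh : f h = S%:C%C.
  rewrite /h /S; elim: N {S h} => [|N IH]; first by rewrite !big_geq.
  by rewrite !big_nat_recr//= addrC fl IH mulrC mul_conjE rmorphD addrC.
have hh : complex.Re (B h h) <= S.
  rewrite {1}/h dot_suml raddf_sum /S /=; apply: ler_sum_nat => n /andP[_ nN].
  rewrite dotZl /h dot_sumr big_mkord (bigD1 (Ordinal nN))//= big1 ?addr0.
    rewrite dotZr conjCK mulrA [X in X * _]mulrC mul_conjE.
    by case: (ue n) => [->|->]; rewrite ?linear0r ?mulr0 ?mulr1//= sqr_ge0.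
  move=> k kn; rewrite dotZr oe ?mulr0// eq_sym; exact: kn.
have S0 : 0 <= S by apply: sumr_ge0 => n _; exact: sqr_ge0.
have := le_trans (fM h) (ler_wpM2l M0 hh).
rewrite fh cabs_real ger0_norm// -/S expr2.
have [->//|Sn0] := eqVneq S 0.
by rewrite ler_pM2r// lt_def Sn0.
Qed.

End GramSchmidt.

(** * The Hilbert space of square-summable sequences *)

Section SquareSummable.
Variables (R : realType).
Local Notation C := (R[i]).

Definition sqsum (f : nat -> C^o) (N : nat) : R := \sum_(0 <= n < N) cabs (f n) ^+ 2.

Definition sqsummable (f : nat -> C^o) : Prop := exists M : R, forall N, sqsum f N <= M.

Definition sqsummable_pred : {pred nat -> C^o} := fun f => `[< sqsummable f >].

Record l2 : Type := L2 {
  l2_fun :> nat -> C^o;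
  l2_subproof : sqsummable_pred l2_fun }.

HB.instance Definition _ := [isSub for l2_fun].
HB.instance Definition _ := [Choice of l2 by <:].

Fact sqsummable_submod_closed : submod_closed sqsummable_pred.
Proof.
split.
- apply/asboolP; exists 0 => N; rewrite /sqsum big1// => n _.
  by rewrite cabs0 expr0n.
- move=> a f g /asboolP[M fM] /asboolP[L gL]; apply/asboolP.
  exists (2 * (cabs a ^+ 2 * M) + 2 * L) => N.
  apply: (@le_trans _ _ (2 * (cabs a ^+ 2 * sqsum f N) + 2 * sqsum g N)).
    rewrite /sqsum !mulr_sumr -big_split /=; apply: ler_sum => n _.
    rewrite !fctE -exprMn -cabsM.
    have := cabsD (a * f n) (g n); have := cabs_ge0 (a * f n + g n).
    by have := sqr_ge0 (cabs (a * f n) - cabs (g n)); nra.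
  by rewrite lerD// ler_pM2l// ler_wpM2l// sqr_ge0.
Qed.

HB.instance Definition _ :=
  GRing.isSubmodClosed.Build C (nat -> C^o) sqsummable_pred
    sqsummable_submod_closed.
HB.instance Definition _ := [SubChoice_isSubLmodule of l2 by <:].

Lemma l2Z a (f : l2) n : (a *: f) n = a * f n. Proof. by []. Qed.

Lemma l2P (f g : l2) : (forall n, f n = g n) -> f = g.
Proof. by move=> fg; apply/val_inj/funext. Qed.

Definition l2dot (f g : l2) : C :=
  limn (fun N => \sum_(0 <= n < N) f n * Num.conj (g n) : C^o).

Lemma sqsum_nondecreasing (f : nat -> C^o) : nondecreasing_seq (sqsum f).
Proof.
apply/nondecreasing_seqP => N; rewrite /sqsum big_nat_recr//= lerDl.
exact: sqr_ge0.
Qed.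

Lemma sqsum_cvg (f : l2) : cvgn (sqsum f).
Proof.
have /asboolP[M fM] := l2_subproof f.
apply: nondecreasing_is_cvgn; first exact: sqsum_nondecreasing.
by exists M => _ [N _ <-].
Qed.

(** The real and imaginary parts of the series are dominated by the convergent
    series of |f n|^2 + |g n|^2. *)
Lemma l2dot_cvg (f g : l2) :
  (fun N => \sum_(0 <= n < N) f n * Num.conj (g n) : C^o) @ \oo -->
  (l2dot f g : C^o).
Proof.
have H (p : C -> R) : {morph p : z w / z + w} -> p 0 = 0 ->
    (forall z, `|p z| <= cabs z) ->
    cvgn (fun N => p (\sum_(0 <= n < N) f n * Num.conj (g n))).
  move=> pD p0 pc; rewrite (_ : (fun N => _) =
      series (fun n => p (f n * Num.conj (g n)))); last first.
    by apply/funext => N; rewrite seriesEnat /=; apply: (big_morph p).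
  apply: normed_cvg; apply: (@series_le_cvg _ _
    (fun n => cabs (f n) ^+ 2 + cabs (g n) ^+ 2)) => [n|n|n|] //=.
  - by rewrite addr_ge0 ?sqr_ge0.
  - rewrite (le_trans (pc _))// cabsM cabs_conj.
    have := cabs_ge0 (f n); have := cabs_ge0 (g n).
    by have := sqr_ge0 (cabs (f n) - cabs (g n)); nra.
  - rewrite (_ : series _ = sqsum f \+ sqsum g).
      by apply: is_cvgD; exact: sqsum_cvg.
    by apply/funext => N; rewrite seriesEnat /= /sqsum -big_split.
have /cvg_ex[a ua] := H (@complex.Re R) (fun z w => raddfD _ z w) erefl (@Re_le_cabs _).
have /cvg_ex[b ub] := H (@complex.Im R) (fun z w => raddfD _ z w) erefl (@Im_le_cabs _).
suff : cvgn (fun N => \sum_(0 <= n < N) f n * Num.conj (g n) : C^o) by [].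
by apply/cvg_ex; exists ((a +i* b)%C : C^o); exact: cvg_complex.
Qed.

Lemma l2dot_lim (f g : l2) (l : C^o) :
  (fun N => \sum_(0 <= n < N) f n * Num.conj (g n) : C^o) @ \oo --> l ->
  l2dot f g = l.
Proof. by move=> fl; apply: (cvg_lim (@norm_hausdorff _ C^o) fl). Qed.

Lemma l2dotC (f g : l2) : l2dot f g = Num.conj (l2dot g f).
Proof.
apply: l2dot_lim.
rewrite [X in X @ \oo --> _](_ : _ = (fun N : nat =>
    Num.conj (\sum_(0 <= n < N) g n * Num.conj (f n)) : C^o)).
  by apply: cvg_conj; exact: l2dot_cvg.
apply/funext => N; rewrite rmorph_sum; apply: eq_bigr => n _.
by rewrite rmorphM /= conjCK mulrC.
Qed.

Lemma l2dot_linearl (h : l2) a (f g : l2) :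
  l2dot (a *: f + g) h = a * l2dot f h + l2dot g h.
Proof.
apply: l2dot_lim.
rewrite [X in X @ \oo --> _](_ : _ =
    (fun N : nat => a *: (\sum_(0 <= n < N) f n * Num.conj (h n) : C^o)) \+
    (fun N : nat => \sum_(0 <= n < N) g n * Num.conj (h n) : C^o)).
  by apply: cvgD; [apply: cvgZl_tmp|]; exact: l2dot_cvg.
apply/funext => N /=; rewrite /GRing.scale /= mulr_sumr -big_split.
apply: eq_bigr => n _; rewrite -[LHS]/((a * f n + g n) * Num.conj (h n)).
by rewrite mulrDl mulrA.
Qed.

Fact l2dot_bilinear : bilinear_for *%R (Num.conj \; *%R) l2dot.
Proof.
split => h a f g; first exact: l2dot_linearl.
by rewrite /= l2dotC l2dot_linearl rmorphD rmorphM /= -!l2dotC.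
Qed.

HB.instance Definition _ := bilinear_isBilinear.Build C l2 l2 C
  *%R (Num.conj \; *%R) l2dot l2dot_bilinear.

Fact l2dot_hermitian (f g : l2) :
  l2dot f g = (-1) ^+ false * Num.conj (l2dot g f).
Proof. by rewrite expr0 mul1r -l2dotC. Qed.

HB.instance Definition _ := isHermitianSesquilinear.Build C l2
  false Num.conj l2dot l2dot_hermitian.

Lemma l2dotE (f : l2) : l2dot f f = (limn (sqsum f))%:C%C.
Proof.
apply: l2dot_lim; apply: cvg_complex.
- rewrite (_ : (fun N => _) = sqsum f); first exact: sqsum_cvg.
  apply/funext => N; rewrite raddf_sum; apply: eq_bigr => n _.
  by rewrite mul_conjE.
- rewrite (_ : (fun N => _) = cst 0); first exact: cvg_cst.
  apply/funext => N; rewrite raddf_sum big1// => n _.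
  by rewrite mul_conjE.
Qed.

Lemma sqsum_le_lim (f : l2) N : sqsum f N <= limn (sqsum f).
Proof.
by apply: nondecreasing_cvgn_le; [exact: sqsum_nondecreasing|exact: sqsum_cvg].
Qed.

Lemma cabs_le_lim (f : l2) n : cabs (f n) ^+ 2 <= limn (sqsum f).
Proof.
apply: le_trans (sqsum_le_lim f n.+1).
by rewrite /sqsum big_nat_recr//= lerDr sumr_ge0// => i _; exact: sqr_ge0.
Qed.

Fact l2dot_gt0 (f : l2) : f != 0 -> 0 < l2dot f f.
Proof.
move=> f0; rewrite l2dotE ltcR.
have [n fn] : exists n, f n != 0.
  apply: contrapT => /forallNP H; move/negP: f0; apply; apply/eqP/l2P => n.
  by apply/eqP; move/negP: (H n); rewrite negbK.
apply: lt_le_trans (cabs_le_lim f n).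
by rewrite exprn_gt0// lt_def cabs_ge0 cabs_eq0 fn.
Qed.

HB.instance Definition _ := isDotProduct.Build C l2 l2dot l2dot_gt0.

Definition l2norm (f : l2) : R := Num.sqrt (limn (sqsum f)).

Lemma sqr_l2norm (f : l2) : l2norm f ^+ 2 = limn (sqsum f).
Proof.
by rewrite sqr_sqrtr// (le_trans _ (sqsum_le_lim f 0))// /sqsum big_geq.
Qed.

Lemma l2norm_ge0 (f : l2) : 0 <= l2norm f. Proof. exact: sqrtr_ge0. Qed.

Lemma Re_l2dot (f : l2) : complex.Re (l2dot f f) = l2norm f ^+ 2.
Proof. by rewrite l2dotE sqr_l2norm. Qed.

Definition l2normC (f : l2) : C := (l2norm f)%:C%C.

Fact l2_normD (f g : l2) : l2normC (f + g) <= l2normC f + l2normC g.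
Proof.
rewrite -rmorphD lecR -(@ler_pXn2r _ 2)// ?nnegrE ?addr_ge0 ?l2norm_ge0//.
rewrite -Re_l2dot !(dotDl, dotDr) !raddfD /= !Re_l2dot.
have := dot_cauchy_schwarz l2dot f g; rewrite !Re_l2dot -exprMn.
rewrite ler_pXn2r ?nnegrE ?cabs_ge0 ?mulr_ge0 ?l2norm_ge0// => fg.
have := le_trans (ler_norm _) (Re_le_cabs (l2dot f g)).
have := le_trans (ler_norm _) (Re_le_cabs (l2dot g f)).
rewrite {2}(l2dotC g f) cabs_conj sqrrD; lra.
Qed.

Fact l2_normZ a (f : l2) : l2normC (a *: f) = `|a| * l2normC f.
Proof.
rewrite cabsE -rmorphM; congr (_%:C%C); apply/eqP.
rewrite -(@eqrXn2 _ 2)// ?mulr_ge0 ?l2norm_ge0 ?cabs_ge0// exprMn -Re_l2dot.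
by rewrite dotZl dotZr mulrA mul_conjE dot_Re Re_l2dot -rmorphM.
Qed.

Fact l2_norm0_eq0 (f : l2) : l2normC f = 0 -> f = 0.
Proof.
move=> [f0]; apply/eqP; rewrite -(dnorm_eq0 l2dot) dot_Re Re_l2dot f0.
by rewrite expr0n.
Qed.

HB.instance Definition _ := Lmodule_isNormed.Build C l2
  l2_normD l2_normZ l2_norm0_eq0.

Lemma sqr_nrm_l2 (f : l2) : nrm f ^+ 2 = limn (sqsum f).
Proof. exact: sqr_l2norm. Qed.

Lemma sqsum_le_nrm (f : l2) N : sqsum f N <= nrm f ^+ 2.
Proof. by rewrite sqr_nrm_l2 sqsum_le_lim. Qed.

Lemma nrm_le_sqsum (f : l2) (M : R) : 0 <= M ->
  (forall N, sqsum f N <= M ^+ 2) -> nrm f <= M.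
Proof.
move=> M0 fM; rewrite -(@ler_pXn2r _ 2)// ?nnegrE ?nrm_ge0// sqr_nrm_l2.
by apply: limr_le; [exact: sqsum_cvg|exact: nearW].
Qed.

Lemma cabs_le_nrm (f : l2) n : cabs (f n) <= nrm f.
Proof.
by rewrite -(@ler_pXn2r _ 2)// ?nnegrE ?nrm_ge0 ?cabs_ge0// sqr_nrm_l2 cabs_le_lim.
Qed.

End SquareSummable.

Section L2Complete.
Variables (R : realType).
Local Notation C := (R[i]).
Local Notation l2 := (l2 R).

Arguments l2_fun : simpl never.

(** Fatou's lemma for finite sums of squares. *)
Lemma sqsum_lim_le (f : nat -> nat -> C^o) (g : nat -> C^o) N (M : R) :
  (forall n, (fun k => f k n) @ \oo --> g n) ->
  (\forall k \near \oo, sqsum (f k) N <= M) -> sqsum g N <= M.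
Proof.
move=> fg fM; have H : (fun k => sqsum (f k) N) @ \oo --> sqsum g N.
  rewrite /sqsum; elim: N {fM} => [|N IH].
    rewrite big_geq// [X in X @ _ --> _](_ : _ = cst 0); first exact: cvg_cst.
    by apply/funext => k; rewrite big_geq.
  rewrite big_nat_recr//= [X in X @ _ --> _](_ : _ =
      (fun k => \sum_(0 <= n < N) cabs (f k n) ^+ 2) \+
      (fun k => cabs (f k N) * cabs (f k N))).
    by have H := cvg_nrm (fg N); apply: cvgD => //; rewrite expr2; apply: cvgM; exact: H.
  by apply/funext => k /=; rewrite big_nat_recr//= expr2.
rewrite -(cvg_lim _ H)//; apply: limr_le => //.
by apply/cvg_ex; eexists; exact: H.
Qed.

(** The coordinatewise limit g of a Cauchy sequence u is not known to be
    square-summable at first; this follows as u_n - g is, by [sqsum_lim_le]. *)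
Lemma l2_seq_complete (u : nat -> l2) : nrm_cauchy u -> cvgn u.
Proof.
move=> cu.
have /choice[g ug] : forall n, exists l : C^o, (fun k => u k n) @ \oo --> l.
  move=> n; apply/cvg_ex/C_cauchy_cvg => e /cu [n0 H]; exists n0 => k m k0 m0.
  by apply: le_lt_trans (H _ _ k0 m0); exact: (cabs_le_nrm (u k - u m)).
have ugN e : 0 < e -> exists n0, forall k, (n0 <= k)%N ->
    forall N, sqsum (fun n => u k n - g n) N <= e ^+ 2.
  move=> e0; have [n0 H] := cu _ e0; exists n0 => k k0 N.
  apply: (@sqsum_lim_le (fun m n => u k n - u m n)) => [n|].
    by apply: cvgB; [exact: cvg_cst|exact: ug].
  exists n0 => // m /= m0; apply: (le_trans (sqsum_le_nrm (u k - u m) N)).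
  by rewrite ler_pXn2r ?nnegrE ?nrm_ge0 ?ltW// H.
have [n1 H1] := ugN _ (@ltr01 R).
have d1 : sqsummable_pred (fun n => u n1 n - g n).
  by apply/asboolP; exists (1 ^+ 2); exact: H1.
pose G : l2 := u n1 - L2 d1.
have GE n : G n = g n by rewrite -[LHS]/(u n1 n - (u n1 n - g n)) subKr.
apply/cvg_ex; exists G; apply/cvg_nrmP => e e0.
have [n0 H] := ugN _ (divr_gt0 e0 (ltr0Sn _ 1)).
exists n0 => // k /= k0; rewrite nrmB.
apply: (@le_lt_trans _ _ (e / 2)); last by rewrite ltr_pdivrMr// ltr_pMr// ltr1n.
apply: nrm_le_sqsum => [|N]; first by rewrite divr_ge0// ltW.
apply: le_trans (H _ k0 N); rewrite le_eqVlt; apply/orP; left; apply/eqP.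
by apply: eq_bigr => n _; rewrite -[(u k - G) n]/(u k n - G n) GE.
Qed.

HB.instance Definition _ := Uniform_isComplete.Build l2
  (nrm_seq_complete l2_seq_complete).

Definition l2H : hilbertType R.
Proof.
refine (@HilbertType R l2 (@l2dot R) _) => f.
by rewrite (dot_Re (@l2dot R) f) Re_l2dot nrmE rmorphXn.
Defined.

Definition l2fin (s : nat -> C^o) (N : nat) : nat -> C^o :=
  fun n => if (n < N)%N then s n else 0.

Fact l2fin_subproof s N : sqsummable_pred (l2fin s N).
Proof.
apply/asboolP; exists (sqsum s N) => M.
apply: (@le_trans _ _ (sqsum (l2fin s N) (maxn M N))).
  by apply: sqsum_nondecreasing; exact: leq_maxl.
rewrite /sqsum (big_cat_nat (n := N)) ?leq_maxr//= [X in _ + X]big1_seq ?addr0.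
  rewrite le_eqVlt; apply/orP; left; apply/eqP; rewrite !big_nat.
  by apply: eq_bigr => n /andP[_ nN]; rewrite /l2fin nN.
move=> n /andP[_]; rewrite mem_index_iota => /andP[Nn _].
by rewrite /l2fin ltnNge Nn /= cabs0 expr0n.
Qed.

Definition l2trunc s N : l2 := L2 (l2fin_subproof s N).

Lemma l2truncE s N n : l2trunc s N n = if (n < N)%N then s n else 0.
Proof. by []. Qed.

Fact l2conj_subproof (f : l2) : sqsummable_pred (fun n => Num.conj (f n) : C^o).
Proof.
apply/asboolP; exists (nrm f ^+ 2) => N; apply: le_trans (sqsum_le_nrm f N).
by rewrite /sqsum; under eq_bigr do rewrite cabs_conj.
Qed.

(** With this conjugation, the bilinear pairing of f and g is the inner product
    of f and [l2conj g]. *)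
Definition l2conj (f : l2) : l2 := L2 (l2conj_subproof f).

Lemma nrm_l2conj (f : l2) : nrm (l2conj f) = nrm f.
Proof.
apply/eqP; rewrite -(@eqrXn2 _ 2)// ?nrm_ge0// !sqr_nrm_l2.
rewrite (_ : sqsum (l2conj f) = sqsum f)//; apply/funext => N.
by apply: eq_bigr => n _; rewrite cabs_conj.
Qed.

Definition l2unit (n : nat) : l2 := l2trunc (fun m => (m == n)%:R) n.+1.

Lemma l2unitE n m : l2unit n m = (m == n)%:R.
Proof.
rewrite l2truncE; case: ltnP => // nm.
by rewrite gtn_eqF.
Qed.

Lemma l2dot_unit (f : l2) n : l2dot f (l2unit n) = f n.
Proof.
apply: l2dot_lim; apply/cvg_nrmP => e e0; exists n.+1 => // N /= nN.
rewrite big_mkord (bigD1 (Ordinal nN))//=.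
rewrite l2unitE eqxx rmorph1 mulr1 big1 ?addr0.
  by rewrite subrr nrm0.
move=> i /negPf ni.
by rewrite l2unitE (_ : (_ == _) = false) ?rmorph0 ?mulr0.
Qed.

Lemma l2_sum_unit (f : l2) N :
  \sum_(0 <= n < N) f n *: l2unit n = l2trunc f N.
Proof.
apply: l2P => k; rewrite l2truncE.
have -> : (\sum_(0 <= n < N) f n *: l2unit n) k =
    \sum_(0 <= n < N) (f n *: l2unit n) k.
  elim: N => [|N IH]; first by rewrite !big_geq.
  by rewrite !big_nat_recr//= -IH.
case: ltnP => kN; last first.
  rewrite big_nat big1// => n /andP[_ nN]; rewrite l2Z l2unitE.
  by rewrite gtn_eqF ?mulr0//; apply: leq_trans kN.
rewrite big_mkord (bigD1 (Ordinal kN))//=.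
rewrite l2Z l2unitE eqxx mulr1 big1 ?addr0//.
move=> i ni; rewrite l2Z l2unitE (_ : (_ == _) = false) ?mulr0//.
by rewrite eq_sym; exact: negPf.
Qed.

Lemma l2trunc_cvg (f : l2) : (fun N => l2trunc f N) @ \oo --> f.
Proof.
apply/cvg_nrmP => e e0.
have /cvgrPdist_lt/(_ (e ^+ 2 / 4)) := @sqsum_cvg _ f.
rewrite divr_gt0 ?exprn_gt0// => /(_ isT)[N0 _ H].
exists N0 => // N /= N0N; apply: (@le_lt_trans _ _ (e / 2)); last first.
  by rewrite ltr_pdivrMr// ltr_pMr// ltr1n.
apply: nrm_le_sqsum => [|M]; first by rewrite divr_ge0// ltW.
have [MN|NM] := leqP M N.
  rewrite /sqsum big_nat big1 ?sqr_ge0// => n /andP[_ nM].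
  rewrite -[(f - _) n]/(f n - l2trunc f N n) l2truncE (leq_trans nM MN).
  by rewrite subrr cabs0 expr0n.
have := H _ N0N; have := sqsum_le_lim f M; set l := limn _.
have -> : sqsum (f - l2trunc f N) M = sqsum f M - sqsum f N.
  rewrite /sqsum (big_cat_nat (n := N))//=; last exact: ltnW.
  rewrite [X in _ = X - _](big_cat_nat (n := N))//=; last exact: ltnW.
  rewrite [X in X + _ = _]big_nat big1 ?add0r => [|n /andP[_ nN]]; last first.
    rewrite -[(f - _) n]/(f n - l2trunc f N n) l2truncE nN.
    by rewrite subrr cabs0 expr0n.
  rewrite addrAC subrr add0r big_nat [RHS]big_nat; apply: eq_bigr => n /andP[Nn _].
  by rewrite -[(f - _) n]/(f n - l2trunc f N n) l2truncE ltnNge Nn subr0.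
rewrite exprMn exprVn (_ : 2 ^+ 2 = 4 :> R); last by rewrite -natrX.
by move=> fM /(le_lt_trans (ler_norm _)); lra.
Qed.

Lemma l2_orthonormal_basis : orthonormal_basis setT (l2unit : nat -> l2H).
Proof.
split=> [m n _ _|f]; first by rewrite /= l2dot_unit l2unitE eq_sym.
rewrite (_ : (fun N => _) = (fun N => l2trunc f N)); first exact: l2trunc_cvg.
apply/funext => N; rewrite -l2_sum_unit; apply: eq_big => n; first exact: in_setT.
by rewrite /= l2dot_unit.
Qed.

Lemma bilinear_pairingE (f g : l2) :
  bilinear_pairing setT (l2unit : nat -> l2H) f g = l2dot f (l2conj g).
Proof.
rewrite /bilinear_pairing /l2dot.
have -> : (fun N => \sum_(0 <= n < N) f n * Num.conj (l2conj g n) : C^o) =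
    (fun N => \sum_(0 <= n < N | n \in setT)
      hdot l2H f (l2unit n) * hdot l2H g (l2unit n) : C^o); last by [].
apply/funext => N; apply: eq_big => n; first by rewrite in_setT.
by rewrite /= !l2dot_unit conjCK.
Qed.

End L2Complete.

(** * Countable dense sets *)

Section RationalComplex.
Variable R : realType.
Local Notation C := (R[i]).

Definition ratC (p : rat * rat) : C := (ratr p.1 +i* ratr p.2)%C.

Lemma ratC_dense (z : C) (e : R) : 0 < e -> exists p, cabs (z - ratC p) < e.
Proof.
move=> e0; have e2 : 0 < e / 2 by rewrite divr_gt0.
have H (x : R) : exists q : rat, `|x - ratr q| < e / 2.
  have /rat_in_itvoo[q] : x < x + e / 2 by rewrite ltrDl.
  rewrite in_itv /= => /andP[h1 h2]; exists q.
  by rewrite distrC ger0_norm ?subr_ge0 ?ltW// ltrBlDl.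
have [[q1 h1] [q2 h2]] := (H (complex.Re z), H (complex.Im z)).
exists (q1, q2); apply: le_lt_trans (cabs_le _) _.
by rewrite [ltRHS]splitr ltrD//; case: z h1 h2.
Qed.

Lemma separable_dense_seq (V : normedModType C) : separable V ->
  exists x : nat -> V, forall v (e : R), 0 < e -> exists i, nrm (v - x i) < e.
Proof.
move=> [A /countable_injP[f finj] dA].
have /choice[x xP] : forall i : nat, exists v : V, forall w, A w -> f w = i -> v = w.
  move=> i; have [[w [Aw fw]]|H] := pselect (exists w, A w /\ f w = i).
    by exists w => w' Aw' fw'; apply: finj; rewrite ?inE// fw.
  by exists 0 => w Aw fw; exfalso; apply: H; exists w.
exists x => v e e0.
have [||w [vw Aw]] := dA (ball v e%:C%C).
- by exists v; apply: ballxx; rewrite ltcR.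
- exact: ball_open.
- by exists (f w); rewrite (xP (f w) w)//; apply/nrm_ballE.
Qed.

Lemma dense_seq_separable (V : normedModType C) (I : countType) (x : I -> V) :
  (forall v (e : R), 0 < e -> exists i, nrm (v - x i) < e) -> separable V.
Proof.
move=> xP; exists (range x); first exact: sub_countable (card_image_le _ _) _.
move=> O [v Ov]; rewrite openE => /(_ _ Ov); rewrite /interior -nbhs_ballE.
move=> [e /= e0 eO]; move: e0; rewrite ltcE => /andP[/eqP i0 e0].
have [j vj] := xP v _ e0; exists (x j); split; last by exists j.
by apply: eO; case: e i0 {e0} vj => a b /= -> vj; apply/nrm_ballE.
Qed.

Lemma l2_separable : separable (l2H R).
Proof.
pose x (s : seq (rat * rat)) : l2 R :=
  l2trunc (fun n => ratC (nth (0, 0) s n)) (size s).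
apply: (@dense_seq_separable _ _ x) => f e e0.
have e2 : 0 < e / 2 by rewrite divr_gt0.
have /cvg_nrmP/(_ _ e2)/filter_ex[N fN] := @l2trunc_cvg _ f.
pose dl := e / 2 / N.+1%:R.
have dl0 : 0 < dl by rewrite !divr_gt0.
have /choice[p pP] : forall n, exists p, cabs (f n - ratC p) < dl.
  by move=> n; exact: ratC_dense.
exists (mkseq p N); apply: le_lt_trans (nrm_triangle (l2trunc f N) _ _) _.
rewrite [ltRHS]splitr ltr_leD//; apply: nrm_le_sqsum => [|K]; first exact: ltW.
have H n : cabs ((l2trunc f N - x (mkseq p N)) n) ^+ 2 <=
    if (n < N)%N then dl ^+ 2 else 0.
  rewrite (_ : l2_fun _ n = l2trunc f N n - x (mkseq p N) n)//.
  rewrite !l2truncE size_mkseq.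
  case: ltnP => nN; last by rewrite subr0 cabs0 expr0n.
  by rewrite nth_mkseq// ler_pXn2r ?nnegrE ?cabs_ge0 ?ltW.
apply: (@le_trans _ _ (\sum_(0 <= n < K) if (n < N)%N then dl ^+ 2 else 0)).
  by apply: ler_sum => n _; exact: H.
have -> : \sum_(0 <= n < K) (if (n < N)%N then dl ^+ 2 else 0) =
    (minn K N)%:R * dl ^+ 2.
  elim: K => [|K IH]; first by rewrite big_geq// min0n mul0r.
  rewrite big_nat_recr//= IH; case: ltnP => KN.
    by rewrite (minn_idPl KN) -natr1 mulrDl mul1r.
  by rewrite addr0 (minn_idPr (leqW KN)).
rewrite /dl expr_div_n mulrCA ler_piMr ?sqr_ge0// ler_pdivrMr ?exprn_gt0// mul1r.
rewrite -natrX ler_nat (leq_trans (geq_minr _ _))// (leq_trans (leqnSn N))//.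
by rewrite -{1}[N.+1]muln1 expnS leq_mul2l expn1.
Qed.

End RationalComplex.

(** * Measurable selection *)

Section MeasurableClusterPoint.
Context (R : realType) (d : measure_display) (T : measurableType d).
Variable S : countType.
Implicit Types (c : nat -> T -> set S).

Definition shrinking c :=
  [/\ forall m n t s, (m <= n)%N -> c n t s -> c m t s,
      forall n s, measurable [set t | c n t s]
    & forall n t, exists s, c n t s].

(** One coordinate v of a cluster point is chosen to be w, the limit in n of the
    infimum of v on c n t (the least cluster value of v): it is measurable
    because S is countable.  Each c n t then has points at which v is as close
    to w t as desired, and selecting them gives a shrinking sequence again, so
    that further coordinates can be treated in turn. *)
Lemma cluster_coordinate c (v : S -> R) (B : R) :
  shrinking c -> (forall s, `|v s| <= B) ->
  exists w : T -> R, [/\ measurable_fun setT w, forall t, `|w t| <= B &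
    shrinking (fun n t s => c n t s /\ `|v s - w t| < n.+1%:R^-1)].
Proof.
move=> [cdec cmeas cne] vB.
(* h n i t is v s when the i-th element s of S is in c n t, and otherwise the
   bound B, which is harmless in an infimum *)
pose h n i t : R := if unpickle i is Some s
  then B + (v s - B) * \1_[set t | c n t s] t else B.
have hE n i t s : unpickle i = Some s ->
    h n i t = if t \in [set t | c n t s] then v s else B.
  rewrite /h => ->; rewrite indicE.
  by case: ifP; rewrite ?mulr1 ?mulr0 ?addr0 // addrC subrK.
have hT n t s : c n t s -> h n (pickle s) t = v s.
  by move=> cs; rewrite (hE _ _ _ _ (pickleK s)) mem_set.
have hP n i t : h n i t = B \/ exists2 s, c n t s & h n i t = v s.
  case E : (unpickle i) => [s|]; last by left; rewrite /h E.
  rewrite (hE _ _ _ _ E); case: ifPn => [/set_mem cs|_]; [right|by left].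
  by exists s.
have hB n i t : - B <= h n i t <= B.
  rewrite -ler_norml; case: (hP n i t) => [->|[s _ ->]//].
  have [s _] := cne 0 t; rewrite ger0_norm//.
  exact: le_trans (vB s).
have hmeas n i : measurable_fun setT (h n i).
  rewrite /h; case: (unpickle i) => [s|]; last exact: measurable_cst.
  apply: measurable_funD; first exact: measurable_cst.
  apply: measurable_funM; first exact: measurable_cst.
  exact/measurable_indic/cmeas.
pose m n t := infs (h n ^~ t) 0.
have sdrop0 (u : nat -> R) : sdrop u 0 = range u.
  by apply/seteqP; split=> x [i _ <-]; exists i.
have infs0 (u : nat -> R) : infs u 0 = inf (range u) by rewrite -(sdrop0 u).
have sups0 (u : nat -> R) : sups u 0 = sup (range u) by rewrite -(sdrop0 u).
have hlb n t : has_lbound (range (h n ^~ t)).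
  by exists (- B) => _ [i _ <-]; have /andP[] := hB n i t.
have m_le n i t : m n t <= h n i t.
  by rewrite /m infs0; apply: ge_inf => //; exists i.
have mB n t : - B <= m n t <= B.
  apply/andP; split.
    rewrite /m infs0; apply: lb_le_inf; first by exists (h n 0 t), 0.
    by move=> _ [i _ <-]; have /andP[] := hB n i t.
  by apply: le_trans (m_le n 0%N t) _; have /andP[] := hB n 0 t.
have m_adh n t e : 0 < e -> exists i, h n i t < m n t + e.
  move=> e0; rewrite /m infs0.
  have [|_ [i _ <-]] := inf_adherent e0 (E := range (h n ^~ t)).
    by split=> //; exists (h n 0 t), 0.
  by exists i.
have mmeas n : measurable_fun setT (m n).
  by apply: measurable_fun_infs => // t _.
have m_homo n1 n2 t : (n1 <= n2)%N -> m n1 t <= m n2 t.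
  move=> n12; rewrite {2}/m infs0; apply: lb_le_inf; first by exists (h n2 0 t), 0.
  move=> _ [i _ <-]; case: (hP n2 i t) => [->|[s cs ->]].
    by have /andP[] := mB n1 t.
  by rewrite -(hT n1 t s); [exact: m_le|exact: cdec cs].
have mub t : has_ubound (range (m ^~ t)).
  by exists B => _ [n _ <-]; have /andP[] := mB n t.
pose w t := sups (m ^~ t) 0.
have w_ge n t : m n t <= w t.
  by rewrite /w sups0; apply: ub_le_sup => //; exists n.
have w_adh t e : 0 < e -> exists n, w t - e < m n t.
  move=> e0; rewrite /w sups0.
  have [|_ [n _ <-]] := sup_adherent e0 (E := range (m ^~ t)).
    by split=> //; exists (m 0 t), 0.
  by exists n.
have wmeas : measurable_fun setT w.
  by apply: measurable_fun_sups => // t _.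
exists w; split=> //.
  move=> t; rewrite ler_norml; apply/andP; split.
    by apply: le_trans (w_ge 0%N t); have /andP[] := mB 0%N t.
  rewrite /w sups0; apply: ge_sup; first by exists (m 0 t), 0.
  by move=> _ [n _ <-]; have /andP[] := mB n t.
split.
- move=> n1 n2 t s n12 [cs vw]; split; first exact: cdec cs.
  by apply: lt_le_trans vw _; rewrite lef_pV2 ?posrE// ler_nat.
- move=> n s.
  rewrite (_ : [set t | _] = [set t | c n t s] `&`
      (fun t => `|v s - w t|) @^-1` [set x : R | x < n.+1%:R^-1])//.
  apply: measurableI => //; rewrite -[X in measurable X]setTI.
  have mf : measurable_fun setT (fun t => `|v s - w t|).
    by apply: measurableT_comp => //; apply: measurable_funB.
  by apply: mf => //; rewrite -set_itvNyo.
- move=> n t; have e0 : 0 < n.+1%:R^-1 / 2 :> R by rewrite divr_gt0 ?invr_gt0.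
  have [n1 wn1] := w_adh t _ e0.
  pose N := maxn n n1.
  have wN : w t - n.+1%:R^-1 / 2 < m N t.
    by apply: lt_le_trans wn1 _; apply: m_homo; exact: leq_maxr.
  have [s cs vs] : exists2 s, c N t s & v s < m N t + n.+1%:R^-1 / 2.
    have [j] := m_adh N t _ e0; case: (hP N j t) => [->|[s cs ->]]; last by exists s.
    move=> ltB; have [s cs] := cne N t; exists s => //; apply: le_lt_trans ltB.
    exact: le_trans (ler_norm _) (vB s).
  exists s; split; first by apply: cdec cs; exact: leq_maxl.
  have := m_le N (pickle s) t; rewrite hT// => mvs.
  have := w_ge N t; move: e0 vs wN mvs; set e := n.+1%:R^-1 / 2.
  rewrite (_ : n.+1%:R^-1 = e + e); last by rewrite /e -splitr.
  by rewrite ltr_norml; lra.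
Qed.

(** The coordinates v 0, v 1, ... are treated one after the other by
    [cluster_coordinate], each time on the sequence obtained at the previous
    step; the n-th sequence controls the coordinates of index less than n. *)
Lemma measurable_cluster_point c (v : nat -> S -> R) (B : nat -> R) :
  shrinking c -> (forall k s, `|v k s| <= B k) ->
  exists w : nat -> T -> R,
    [/\ forall k, measurable_fun setT (w k), forall k t, `|w k t| <= B k &
    forall n t, exists2 s, c n t s &
      forall k, (k < n)%N -> `|v k s - w k t| < n.+1%:R^-1].
Proof.
move=> c_shr vB.
have step k (x : {c | shrinking c}) : exists w : T -> R,
    [/\ measurable_fun setT w, forall t, `|w t| <= B k &
    shrinking (fun n t s => sval x n t s /\ `|v k s - w t| < n.+1%:R^-1)].
  exact: cluster_coordinate (svalP x) (vB k).
pose W k x := sval (cid (step k x)).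
have WP k x := svalP (cid (step k x)).
pose X := fix X k := if k is k'.+1 then
   exist shrinking (fun n t s =>
       sval (X k') n t s /\ `|v k' s - W k' (X k') t| < n.+1%:R^-1)
     (let: And3 _ _ h := WP k' (X k') in h)
 else exist shrinking c c_shr.
exists (fun k => W k (X k)); split=> [k|k t|n t].
- by have [+ _ _] := WP k (X k).
- by have [_ + _] := WP k (X k); exact.
have [_ _ ne] := svalP (X n); have [s Xs] := ne n t.
have subX j k : sval (X (j + k)%N) n t s -> sval (X k) n t s.
  by elim: j => // j IH [/IH].
exists s => [|k kn]; first by apply: (subX n 0%N); rewrite addn0.
by have [] : sval (X k.+1) n t s by apply: (subX (n - k.+1)%N); rewrite subnK.
Qed.

End MeasurableClusterPoint.

Section MeasurableSelection.
Context (R : realType) (d : measure_display) (T : measurableType d).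

Definition clip (B x : R) : R := Num.max (- B) (Num.min B x).

Lemma norm_clip (B x : R) : 0 <= B -> `|clip B x| <= B.
Proof.
move=> B0; rewrite /clip ler_norml /Num.max /Num.min.
by case: ifPn => [|]; case: ifPn => [|]; rewrite -?leNgt => *; lra.
Qed.

Lemma clip_dist (B x w : R) : `|w| <= B -> `|clip B x - w| <= `|x - w|.
Proof.
rewrite ler_norml => /andP[w1 w2]; rewrite /clip /Num.max /Num.min.
have := ler_norm (x - w); have := ler_norm (w - x); rewrite distrC => H1 H2.
by case: ifPn => [|]; case: ifPn => [|]; rewrite -?leNgt ler_norml => *; lra.
Qed.

Variables (J M : countType) (g : M -> T -> (J -> R) -> R) (B : J -> R).
Hypothesis B_ge0 : forall j, 0 <= B j.
Hypothesis g_cont : forall m t (u : nat -> J -> R) (w : J -> R),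
  (forall j, (fun n => u n j) @ \oo --> w j) ->
  (fun n => g m t (u n)) @ \oo --> g m t w.
Hypothesis g_meas : forall m w, measurable_fun setT (fun t => g m t w).
Hypothesis g_approx : forall t (e : R), 0 < e ->
  exists2 w : J -> R, (forall j, `|w j| <= B j) & (forall m, g m t w <= e).

(** A countable family of points of the product of the [- B j, B j]; by
    [grid_dense] it is dense for coordinatewise convergence. *)
Definition grid (s : seq rat) (j : J) : R := clip (B j) (ratr (nth 0 s (pickle j))).

Lemma norm_grid s j : `|grid s j| <= B j. Proof. exact: norm_clip. Qed.

Lemma grid_dense (w : J -> R) : (forall j, `|w j| <= B j) ->
  exists s : nat -> seq rat, forall j, (fun n => grid (s n) j) @ \oo --> w j.
Proof.
move=> wB.
have /choice[r rP] : forall jn : J * nat, exists q : rat,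
    `|ratr q - w jn.1| < (jn.2).+1%:R^-1.
  move=> [j n] /=; have : w j < w j + n.+1%:R^-1 by rewrite ltrDl.
  move=> /rat_in_itvoo[q]; rewrite in_itv /= => /andP[h1 h2]; exists q.
  by rewrite ger0_norm ?subr_ge0 ?ltW// ltrBlDl.
exists (fun n => mkseq (fun i => if unpickle i is Some j then r (j, n) else 0) n).
move=> j; apply/cvgrPdist_lt => e e0; near=> n; rewrite distrC.
rewrite (le_lt_trans (clip_dist _ (wB j)))// nth_mkseq; last first.
  by near: n; exact: nbhs_infty_gt.
rewrite pickleK; apply: lt_trans (rP (j, n)) _.
by near: n; exact: inv_nat_lt.
Unshelve. all: by end_near. Qed.

Let c (n : nat) (t : T) : set (seq rat) :=
  [set s | forall m : M, (pickle m < n)%N -> g m t (grid s) < n.+1%:R^-1].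

Lemma c_shrinking : shrinking c.
Proof.
split.
- move=> n1 n2 t s n12 H m mn1.
  apply: lt_le_trans (H m (leq_trans mn1 n12)) _.
  by rewrite lef_pV2 ?posrE// ler_nat.
- move=> n s.
  pose F i := [set t | forall m : M,
    pickle m = i -> (i < n)%N -> g m t (grid s) < n.+1%:R^-1].
  rewrite (_ : [set t | _] = \bigcap_i F i); last first.
    apply/seteqP; split=> t /=; first by move=> H i _ m <- /H.
    by move=> H m mn; exact: (H (pickle m)).
  apply: bigcapT_measurable => i.
  have [in_|] := ltnP i n; last first.
    move=> ni; rewrite (_ : F i = setT)//; apply/seteqP; split=> // t _ m _.
    by rewrite ltnNge ni.
  case E : (@pickle_inv M i) => [m|].
    have mi : pickle m = i by have := @pickle_invK M i; rewrite E; apply.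
    rewrite (_ : F i = (fun t => g m t (grid s)) @^-1` [set x : R | x < n.+1%:R^-1]).
      rewrite -[X in measurable X]setTI; apply: g_meas => //.
      by rewrite -set_itvNyo.
    apply/seteqP; split=> t /=; first by move=> H; exact: H.
    by move=> H m' m'i _; rewrite (_ : m' = m)//; apply: (pcan_inj pickleK); rewrite m'i.
  rewrite (_ : F i = setT)//; apply/seteqP; split=> // t _ m mi.
  by move: E; rewrite -mi pickleK_inv.
- move=> n t; have e0 : 0 < n.+1%:R^-1 / 2 :> R by rewrite divr_gt0 ?invr_gt0.
  have [w wB wg] := g_approx t e0; have [s sw] := grid_dense wB.
  have ev m : \forall k \near \oo, g m t (grid (s k)) < n.+1%:R^-1.
    have /cvgrPdist_lt/(_ _ e0) : (fun k => g m t (grid (s k))) @ \oo --> g m t w.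
      exact: g_cont sw.
    apply: filterS => k; have := wg m.
    rewrite distrC => gw /(le_lt_trans (ler_norm _)); rewrite ltrBlDr => /lt_le_trans.
    by apply; rewrite [leRHS]splitr lerD2l.
  have H N : \forall k \near \oo, forall m : M, (pickle m < N)%N ->
      g m t (grid (s k)) < n.+1%:R^-1.
    elim: N => [|N IH]; first by near=> k.
    case E : (@pickle_inv M N) => [m0|].
      have mi : pickle m0 = N by have := @pickle_invK M N; rewrite E; apply.
      apply: filterS2 IH (ev m0) => k IH H m.
      rewrite ltnS leq_eqVlt => /orP[/eqP mN|/IH//].
      by rewrite (_ : m = m0)//; apply: (pcan_inj pickleK); rewrite mN.
    apply: filterS IH => k IH m; rewrite ltnS leq_eqVlt => /orP[/eqP mN|/IH//].
    by move: E; rewrite -mN pickleK_inv.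
  by have [k Hk] := filter_ex (H n); exists (s k).
Unshelve. all: by end_near. Qed.

(** The set of solutions w of the countably many conditions g m t w <= 0 is
    compact for coordinatewise convergence.  A solution for t is obtained as a
    cluster point of approximate solutions taken in a countable dense set: the
    cluster point is measurable in t by [measurable_cluster_point], and solves
    the conditions by continuity.  In particular approximate solvability at
    each t is enough. *)
Lemma measurable_selection : exists w : J -> T -> R,
  [/\ forall j, measurable_fun setT (w j), forall j t, `|w j t| <= B j
    & forall m t, g m t (fun j => w j t) <= 0].
Proof.
pose v (k : nat) (s : seq rat) := if unpickle k is Some j then grid s j else 0.
pose B' (k : nat) := if @unpickle J k is Some j then B j else 0.
have vB k s : `|v k s| <= B' k.
  by rewrite /v /B'; case: unpickle => [j|]; rewrite ?norm_grid ?normr0.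
have [w [wm wB wc]] := measurable_cluster_point c_shrinking vB.
exists (fun j => w (pickle j)); split=> [j|j t|m t]; first exact: wm.
  by have := wB (pickle j) t; rewrite /B' pickleK.
have /choice[s sP] : forall n, exists s, c n t s /\
    forall k, (k < n)%N -> `|v k s - w k t| < n.+1%:R^-1.
  by move=> n; have [s cs H] := wc n t; exists s.
have sw j : (fun n => grid (s n) j) @ \oo --> w (pickle j) t.
  apply/cvgrPdist_lt => e e0; near=> n; rewrite distrC.
  have [_ /(_ (pickle j))] := sP n; rewrite /v pickleK => H.
  apply: lt_trans (H _) _; last by near: n; exact: inv_nat_lt.
  by near: n; exact: nbhs_infty_gt.
have gw : (fun n => g m t (grid (s n))) @ \oo --> g m t (fun j => w (pickle j) t).
  exact: g_cont sw.
apply: (ler_cvg_to gw (@cvg_harmonic R)); near=> n; apply/ltW.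
by have [+ _] := sP n; apply; near: n; exact: nbhs_infty_gt.
Unshelve. all: by end_near. Qed.

End MeasurableSelection.

(** * Operators defined on a dense sequence *)

Section DenseExtension.
Variable R : realType.
Local Notation C := (R[i]).
Variables (V : normedModType C) (W : completeNormedModType C).
Variables (x : nat -> V) (a : nat -> W) (M : R).
Hypothesis x_dense : forall v (e : R), 0 < e -> exists i, nrm (v - x i) < e.
Hypothesis M0 : 0 <= M.
(** This single family of inequalities makes [x i |-> a i] both Lipschitz and
    linear in the limit: when x k tends to p x i + x j, it forces a k to tend to
    p a i + a j. *)
Hypothesis a_le : forall p i j k,
  nrm (ratC R p *: a i + a j - a k) <= M * nrm (ratC R p *: x i + x j - x k).

(* by density of the rational scalars *)
Let a_leC (c : C) i j k :
  nrm (c *: a i + a j - a k) <= M * nrm (c *: x i + x j - x k).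
Proof.
apply/ler_addgt0Pr => e e0.
pose K := nrm (a i) + M * nrm (x i).
have K0 : 0 <= K by rewrite addr_ge0 ?mulr_ge0 ?nrm_ge0.
have [|p cp] := @ratC_dense R c (e / (K + 1)); first by rewrite divr_gt0// ltr_wpDl.
set q := ratC R p in cp.
have H (U : normedModType C) (u v w : U) :
    nrm (c *: u + v - w) <= cabs (c - q) * nrm u + nrm (q *: u + v - w).
  have -> : c *: u + v - w = (c - q) *: u + (q *: u + v - w).
    by rewrite scalerBl !addrA subrK.
  by rewrite (le_trans (nrmD _ _))// nrmZ.
have H' (U : normedModType C) (u v w : U) :
    nrm (q *: u + v - w) <= cabs (c - q) * nrm u + nrm (c *: u + v - w).
  have -> : q *: u + v - w = (q - c) *: u + (c *: u + v - w).
    by rewrite scalerBl !addrA subrK.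
  by rewrite (le_trans (nrmD _ _))// nrmZ -/(cabs _) -(cabsN (q - c)) opprB.
apply: le_trans (H _ _ _ _) _; apply: le_trans (lerD (lexx _) (a_le _ _ _ _)) _.
apply: le_trans (lerD (lexx _) (ler_wpM2l M0 (H' _ _ _ _))) _.
have : cabs (c - q) * K <= e.
  rewrite (le_trans (ler_wpM2r K0 (ltW cp)))// mulrAC ler_pdivrMr ?ltr_wpDl//.
  by rewrite ler_pM2l// lerDl.
by rewrite /K; lra.
Qed.

Let lim_le (u : nat -> W) (v : nat -> V) lu lv :
  u @ \oo --> lu -> v @ \oo --> lv -> (forall n, nrm (u n) <= M * nrm (v n)) ->
  nrm lu <= M * nrm lv.
Proof.
move=> /cvg_nrm ulu /cvg_nrm vlv uv.
by apply: (ler_cvg_to ulu (cvgMl_tmp (a := M) vlv)); exact: nearW.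
Qed.

Lemma dense_extension : exists f : bop V W,
  (forall i, f (x i) = a i) /\ (forall v, nrm (f v) <= M * nrm v).
Proof.
have /choice[s sP] : forall vn : V * nat, exists i, nrm (vn.1 - x i) < vn.2.+1%:R^-1.
  by move=> [v n]; apply: x_dense; rewrite invr_gt0.
have xs v : (fun n => x (s (v, n))) @ \oo --> v.
  apply/cvg_nrmP => e e0; near=> n; apply: lt_trans (sP (v, n)) _.
  by near: n; exact: inv_nat_lt.
have aB j k : nrm (a j - a k) <= M * nrm (x j - x k).
  by have := a_leC 0 j j k; rewrite !scale0r !add0r.
have ca v : cvgn (fun n => a (s (v, n))).
  apply: nrm_cauchy_cvg => e e0.
  have d0 : 0 < e / 2 / (M + 1) by rewrite !divr_gt0// ltr_wpDl.
  have /cvg_nrmP/(_ _ d0)[n0 _ H] := xs v; exists n0 => m n m0 n0n.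
  have M1 : 0 < M + 1 by rewrite ltr_wpDl.
  have xx : nrm (x (s (v, m)) - x (s (v, n))) < e / (M + 1).
    rewrite (le_lt_trans (nrm_triangle v _ _))//.
    rewrite (_ : e / (M + 1) = e / 2 / (M + 1) + e / 2 / (M + 1)).
      by rewrite ltrD ?H// nrmB H.
    by rewrite -mulrDl -splitr.
  apply: le_lt_trans (aB _ _) _.
  apply: (@le_lt_trans _ _ ((M + 1) * nrm (x (s (v, m)) - x (s (v, n))))).
    by rewrite ler_wpM2r ?nrm_ge0// lerDl.
  by rewrite mulrC -ltr_pdivlMr.
pose f v := limn (fun n => a (s (v, n))).
have af v : (fun n => a (s (v, n))) @ \oo --> f v by exact: ca.
have fl c u v : f (c *: u + v) = c *: f u + f v.
  apply/eqP; rewrite eq_sym -subr_eq0 -nrm_eq0 eq_le nrm_ge0 andbT.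
  rewrite -[leRHS](mulr0 M) -[X in M * X](nrm0 V) -(subrr (c *: u + v)).
  apply: (@lim_le
    (fun n => c *: a (s (u, n)) + a (s (v, n)) - a (s (c *: u + v, n)))
    (fun n => c *: x (s (u, n)) + x (s (v, n)) - x (s (c *: u + v, n)))).
  - by apply: cvgB => //; apply: cvgD => //; exact: cvgZl_tmp.
  - by apply: cvgB => //; apply: cvgD => //; exact: cvgZl_tmp.
  - by move=> n; exact: a_leC.
have f0 : f 0 = 0.
  by have := fl (-1) 0 0; rewrite scaler0 addr0 scaleN1r addNr.
have fM v : nrm (f v) <= M * nrm v.
  rewrite -(subr0 (f v)) -f0 -[X in M * nrm X]subr0.
  apply: (@lim_le (fun n => a (s (v, n)) - a (s (0, n)))
    (fun n => x (s (v, n)) - x (s (0, n)))); [exact: cvgB|exact: cvgB|].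
  by move=> n; exact: aB.
have fB : bounded_linear_pred f by apply/asboolP; split=> //; exists M.
exists (Bop fB); split=> // i.
apply/eqP; rewrite -subr_eq0 -nrm_eq0 eq_le nrm_ge0 andbT.
rewrite -[leRHS](mulr0 M) -[X in M * X](nrm0 V) -(subrr (x i)).
apply: (@lim_le (fun n => a (s (x i, n)) - a i) (fun n => x (s (x i, n)) - x i)).
- by apply: cvgB; [exact: af|exact: cvg_cst].
- by apply: cvgB; [exact: xs|exact: cvg_cst].
- by move=> n; exact: aB.
Unshelve. all: by end_near. Qed.

End DenseExtension.

(** * Coordinates of a Hilbert factorization *)

Section Gamma2Coordinates.
Variable R : realType.
Local Notation C := (R[i]).
Variables (E F : normedModType C).

Lemma bopD (V W : normedModType C) (f : bop V W) (u v : V) : f (u + v) = f u + f v.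
Proof. by have := bop_linear f 1 u v; rewrite !scale1r. Qed.

Lemma Re_hdot (K : hilbertType R) (h : K) : complex.Re (hdot K h h) = nrm h ^+ 2.
Proof. by rewrite hdotE nrmE -rmorphXn. Qed.

(** Factor u = be \o al through a Hilbert space with ||al|| ||be|| close to
    gamma2 u, and let (e_n) be the Gram-Schmidt system of the vectors al (x_i).
    Up to a scaling that makes al a contraction, a v n is the coordinate of al v
    on e_n and b w n is the value at w of be (e_n).  Taking values of be, and not
    vectors representing them, makes b linear and the last formula bilinear;
    Bessel's inequality gives both bounds. *)
Lemma gamma2_coordinates (u : bop E (dual F)) (c dl : R) (x : nat -> E) :
  0 <= c -> 0 < dl -> Gamma2 u -> gamma2 u <= c ->
  exists (a : E -> nat -> C) (b : F -> nat -> C),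
  [/\ (forall s v w n, a (s *: v + w) n = s * a v n + a w n) /\
      (forall s v w n, b (s *: v + w) n = s * b v n + b w n),
      forall v N, \sum_(0 <= n < N) cabs (a v n) ^+ 2 <= nrm v ^+ 2,
      forall w N, \sum_(0 <= n < N) cabs (b w n) ^+ 2
        <= (c ^+ 2 + dl) * nrm w ^+ 2,
      forall i n, (i < n)%N -> a (x i) n = 0
    & forall i w, u (x i) w = \sum_(0 <= n < i.+1) a (x i) n * b w n].
Proof.
move=> c0 dl0 uG uc.
have : gamma2 u < Num.sqrt (c ^+ 2 + dl).
  apply: le_lt_trans uc _; rewrite -(@ltr_pXn2r _ 2)// ?nnegrE ?sqrtr_ge0//.
  by rewrite sqr_sqrtr ?ltrDl// addr_ge0 ?sqr_ge0 ?ltW.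
move=> /(inf_lt uG)[r [K [al [be [ube rE]]]] rc].
have r0 : 0 <= r by rewrite rE mulr_ge0 ?nrm_ge0.
have {}rc : r ^+ 2 <= c ^+ 2 + dl.
  rewrite -[leRHS]sqr_sqrtr ?ler_pXn2r ?nnegrE ?sqrtr_ge0 ?(ltW rc)//.
  by rewrite addr_ge0 ?sqr_ge0 ?ltW.
pose L := nrm al.
have [L0|Ln0] := eqVneq L 0.
  exists (fun _ _ => 0), (fun _ _ => 0); split.
  - by split=> *; rewrite mulr0 addr0.
  - by move=> v N; rewrite big1 ?sqr_ge0// => n _; rewrite cabs0 expr0n.
  - move=> v N; rewrite big1 => [|n _]; last by rewrite cabs0 expr0n.
    by apply: mulr_ge0 (sqr_ge0 _); rewrite addr_ge0 ?sqr_ge0 ?ltW.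
  - by [].
  - move=> i w; rewrite ube big1 => [|n _]; last by rewrite mulr0.
    rewrite (_ : al (x i) = 0) ?bop0//; apply/eqP.
    rewrite -nrm_eq0 eq_le nrm_ge0 andbT (le_trans (le_opnorm al _))//.
    by rewrite (L0 : opnorm al = 0) mul0r.
have Lgt0 : 0 < L by rewrite lt_def Ln0 nrm_ge0.
have [e eo ve] := gram_schmidt (hdot K) (fun i => al (x i)).
exists (fun v n => L^-1%:C%C * hdot K (al v) (e n)),
  (fun w n => L%:C%C * be (e n) w).
split.
- split=> s v w n.
    by rewrite bop_linear dotDl dotZl; ring.
  by rewrite bop_linear; rewrite /GRing.scale /=; ring.
- move=> v N.
  have := @bessel_functional _ _ (hdot K) e (fun h => hdot K h (al v))
    (nrm (al v) ^+ 2) eo.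
  move=> /(_ _ _ _ N); rewrite sqr_ge0 => /(_ _ isT _).
  have -> : \sum_(0 <= n < N) cabs (L^-1%:C%C * hdot K (al v) (e n)) ^+ 2 =
      L ^- 2 * \sum_(0 <= n < N) cabs (hdot K (e n) (al v)) ^+ 2.
    rewrite mulr_sumr; apply: eq_bigr => n _; rewrite cabsM exprMn.
    by rewrite cabs_real ger0_norm ?invr_ge0 ?ltW// exprVn dotC cabs_conj.
  move=> H; rewrite ler_pdivrMl ?exprn_gt0//.
  apply: le_trans (H _ _) _; first by move=> s h k; rewrite dotDl dotZl.
    by move=> h; rewrite -Re_hdot mulrC dot_cauchy_schwarz.
  by rewrite -exprMn ler_pXn2r ?nnegrE ?mulr_ge0 ?nrm_ge0// le_opnorm.
- move=> w N.
  have := @bessel_functional _ _ (hdot K) e (fun h => be h w)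
    ((nrm be * nrm w) ^+ 2) eo.
  move=> /(_ _ _ _ N); rewrite sqr_ge0 => /(_ _ isT _).
  have -> : \sum_(0 <= n < N) cabs (L%:C%C * be (e n) w) ^+ 2 =
      L ^+ 2 * \sum_(0 <= n < N) cabs (be (e n) w) ^+ 2.
    rewrite mulr_sumr; apply: eq_bigr => n _; rewrite cabsM exprMn.
    by rewrite cabs_real ger0_norm ?ltW.
  move=> H; apply: (@le_trans _ _ (L ^+ 2 * (nrm be * nrm w) ^+ 2)); last first.
    by rewrite -exprMn mulrA exprMn -rE ler_wpM2r ?sqr_ge0.
  rewrite ler_wpM2l ?sqr_ge0//; apply: H => [s h k|h]; first by rewrite bop_linear.
  rewrite Re_hdot -exprMn ler_pXn2r ?nnegrE ?mulr_ge0 ?nrm_ge0 ?cabs_ge0//.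
  apply: (le_trans (le_opnorm (be h) w)).
  by rewrite mulrAC ler_wpM2r ?nrm_ge0//; exact: (le_opnorm be h).
- move=> i n ltin; rewrite ve dot_suml big_nat big1 ?mulr0// => k /andP[_ ki].
  by rewrite dotZl eo.1 ?mulr0// ltn_eqF// (leq_trans ki).
- move=> i w; rewrite ube {1}ve.
  transitivity (\sum_(0 <= n < i.+1) hdot K (al (x i)) (e n) * be (e n) w).
    elim: i.+1 => [|N IH]; first by rewrite !big_geq// bop0.
    by rewrite !big_nat_recr//= bopD -IH bopZ.
  apply: eq_bigr => n _; rewrite mulrACA -rmorphM mulVf ?gt_eqF//.
  by rewrite rmorph1 mul1r.
Qed.

End Gamma2Coordinates.

(** * Measurable choice of a factorization *)

Lemma cvg_sum_nat (K : numFieldType) (V : normedModType K) (f : nat -> nat -> V)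
    (l : nat -> V) N :
  (forall n, (fun k => f k n) @ \oo --> l n) ->
  (fun k => \sum_(0 <= n < N) f k n) @ \oo --> \sum_(0 <= n < N) l n.
Proof.
move=> fl; elim: N => [|N IH].
  rewrite big_geq// [X in X @ _ --> _](_ : _ = cst 0); first exact: cvg_cst.
  by apply/funext => k; rewrite big_geq.
rewrite big_nat_recr//= [X in X @ _ --> _](_ : _ =
    (fun k => \sum_(0 <= n < N) f k n) \+ (fun k => f k N)); first exact: cvgD.
by apply/funext => k /=; rewrite big_nat_recr.
Qed.

Section MeasurableC.
Context (R : realType) (d : measure_display) (T : measurableType d).
Local Notation C := (R[i]).
Implicit Types f g : T -> C.

Lemma measurable_C_cst (z : C) : measurable_C (fun _ : T => z).
Proof. by split; exact: measurable_cst. Qed.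

Lemma measurable_CD f g : measurable_C f -> measurable_C g ->
  measurable_C (fun t => f t + g t).
Proof.
move=> [f1 f2] [g1 g2]; split.
- rewrite (_ : (fun t => _) = (fun t => complex.Re (f t)) \+ (fun t => complex.Re (g t))).
    exact: measurable_funD.
  by apply/funext => t /=; rewrite raddfD.
- rewrite (_ : (fun t => _) = (fun t => complex.Im (f t)) \+ (fun t => complex.Im (g t))).
    exact: measurable_funD.
  by apply/funext => t /=; rewrite raddfD.
Qed.

Lemma measurable_CM f g : measurable_C f -> measurable_C g ->
  measurable_C (fun t => f t * g t).
Proof.
move=> [f1 f2] [g1 g2]; split.
- rewrite (_ : (fun t => _) =
    ((fun t => complex.Re (f t)) \* (fun t => complex.Re (g t))) \-
    ((fun t => complex.Im (f t)) \* (fun t => complex.Im (g t)))).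
    by apply: measurable_funB; exact: measurable_funM.
  by apply/funext => t /=; case: (f t) => ? ?; case: (g t).
- rewrite (_ : (fun t => _) =
    ((fun t => complex.Re (f t)) \* (fun t => complex.Im (g t))) \+
    ((fun t => complex.Im (f t)) \* (fun t => complex.Re (g t)))).
    by apply: measurable_funD; exact: measurable_funM.
  by apply/funext => t /=; case: (f t) => ? ?; case: (g t).
Qed.

Lemma measurable_C_sum (I : Type) (r : seq I) (f : I -> T -> C) :
  (forall i, measurable_C (f i)) -> measurable_C (fun t => \sum_(i <- r) f i t).
Proof.
move=> mf; elim: r => [|i r IH].
  rewrite (_ : (fun t => _) = fun=> 0); first exact: measurable_C_cst.
  by apply/funext => t; rewrite big_nil.
rewrite (_ : (fun t => _) = (fun t => f i t + \sum_(j <- r) f j t)).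
  exact: measurable_CD.
by apply/funext => t; rewrite big_cons.
Qed.

Lemma measurable_sqr_cabs f : measurable_C f ->
  measurable_fun setT (fun t => cabs (f t) ^+ 2).
Proof.
move=> [f1 f2]; rewrite (_ : (fun t => _) =
  (fun t => complex.Re (f t) ^+ 2) \+ (fun t => complex.Im (f t) ^+ 2)).
  by apply: measurable_funD; exact: measurable_funX.
by apply/funext => t /=; rewrite sqr_cabs.
Qed.

Lemma measurable_fun_sqrt (f : T -> R) : measurable_fun setT f ->
  measurable_fun setT (fun t => Num.sqrt (f t)).
Proof.
move=> mf; apply: (@measurableT_comp _ _ _ _ _ _ (@Num.sqrt R)) => //.
by apply: continuous_measurable_fun; exact: sqrt_continuous.
Qed.

Lemma measurable_cabs f : measurable_C f ->
  measurable_fun setT (fun t => cabs (f t)).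
Proof.
move=> mf; rewrite (_ : (fun t => _) = (fun t => Num.sqrt (cabs (f t) ^+ 2))).
  by apply: measurable_fun_sqrt; exact: measurable_sqr_cabs.
by apply/funext => t; rewrite sqrtr_sqr ger0_norm ?cabs_ge0.
Qed.

Lemma measurable_C_cvg (f : nat -> T -> C) (l : T -> C) :
  (forall n, measurable_C (f n)) ->
  (forall t, (fun n => f n t : C^o) @ \oo --> (l t : C^o)) -> measurable_C l.
Proof.
move=> mf fl; split.
- apply: (@measurable_fun_cvg _ _ _ _ (fun n t => complex.Re (f n t))) => [n|t _].
    by have [] := mf n.
  exact: (cvg_Re (fl t)).
- apply: (@measurable_fun_cvg _ _ _ _ (fun n t => complex.Im (f n t))) => [n|t _].
    by have [] := mf n.
  exact: (cvg_Im (fl t)).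
Qed.

End MeasurableC.

Section MeasurableFactorization.
Context (R : realType) (d : measure_display) (T : measurableType d).
Local Notation C := (R[i]).
Variables (E F : normedModType C) (x : nat -> E) (y : nat -> F) (c : R).
Variable phi : T -> bop E (dual F).
Hypothesis c0 : 0 <= c.
Hypothesis phiG : forall t, Gamma2 (phi t).
Hypothesis phic : forall t, gamma2 (phi t) <= c.
Hypothesis phim : forall i j, measurable_C (fun t => phi t (x i) (y j)).

(* The unknowns are the real and imaginary parts of the entries of two arrays:
   (s, i, n, r) is the entry of row i and column n of the array of x if s, and
   of the array of y otherwise. *)
Let J : countType := (bool * nat * nat * bool)%type.
(* The conditions on the unknowns: the left summand bounds the partial sums up to
   N of the combination of three rows; the right one gives the value of phi t at
   (x i, y j). *)
Let M : countType :=
  (bool * (rat * rat) * (nat * nat * nat) * nat + nat * nat)%type.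

Let z (w : J -> R) s i n : C := (w (s, i, n, true) +i* w (s, i, n, false))%C.

Let comb (a : nat -> nat -> C) p i j k n := ratC R p * a i n + a j n - a k n.

Let nv (s : bool) p i j k : R :=
  if s then nrm (ratC R p *: x i + x j - x k)
  else nrm (ratC R p *: y i + y j - y k).

Let kap (s : bool) : R := if s then 1 else c ^+ 2.

(* The division by 1 + nv^2 makes a common error e for all the conditions
   compatible with the error on c^2 in gamma2_coordinates. *)
Let g (m : M) (t : T) (w : J -> R) : R :=
  match m with
  | inl (s, p, (i, j, k), N) =>
     ((\sum_(0 <= n < N) cabs (comb (z w s) p i j k n) ^+ 2) -
       kap s * nv s p i j k ^+ 2) / (1 + nv s p i j k ^+ 2)
  | inr (i, j) =>
     cabs (phi t (x i) (y j) - \sum_(0 <= n < i.+1) z w true i n * z w false j n)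
  end.

(* The value 0 for i < n makes the array of x triangular. *)
Let B (j : J) : R :=
  let: (s, i, n, _) := j in
  if s then if (n <= i)%N then nrm (x i) else 0
  else Num.sqrt (c ^+ 2 + 1) * nrm (y i).

Let B_ge0 j : 0 <= B j.
Proof.
case: j => [[[[] i] n] ?] /=; last by rewrite mulr_ge0 ?sqrtr_ge0 ?nrm_ge0.
by case: ifP => _ //; exact: nrm_ge0.
Qed.

Let g_cont m t (u : nat -> J -> R) (w : J -> R) :
  (forall j, (fun n => u n j) @ \oo --> w j) ->
  (fun n => g m t (u n)) @ \oo --> g m t w.
Proof.
move=> uw.
have zw s i n : (fun k => z (u k) s i n : C^o) @ \oo --> (z w s i n : C^o).
  by apply: cvg_complex; exact: uw.
case: m => [[[[s p] [[i j] k]] N]|[i j]] /=.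
  apply: cvgMr_tmp; apply: cvgB; last exact: cvg_cst.
  apply: cvg_sum_nat => n; rewrite expr2.
  have H : (fun l => comb (z (u l) s) p i j k n : C^o) @ \oo -->
      (comb (z w s) p i j k n : C^o).
    exact: (cvgB (cvgD (cvgMl_tmp (zw s i n)) (zw s j n)) (zw s k n)).
  have H' := cvg_nrm H; apply: cvgM; exact: H'.
have H : (fun l => phi t (x i) (y j) -
   \sum_(0 <= n < i.+1) z (u l) true i n * z (u l) false j n : C^o) @ \oo -->
   (phi t (x i) (y j) - \sum_(0 <= n < i.+1) z w true i n * z w false j n : C^o).
  apply: cvgB; first exact: cvg_cst.
  apply: (@cvg_sum_nat _ C^o) => n.
  exact: (cvgM (zw true i n) (zw false j n)).
exact: (cvg_nrm H).
Qed.

Let g_meas m w : measurable_fun setT (fun t => g m t w).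
Proof.
case: m => [[[[s p] [[i j] k]] N]|[i j]] /=; first exact: measurable_cst.
apply: measurable_cabs; apply: measurable_CD => //; exact: measurable_C_cst.
Qed.

Let g_approx t (e : R) : 0 < e ->
  exists2 w : J -> R, (forall j, `|w j| <= B j) & (forall m, g m t w <= e).
Proof.
move=> e0; pose dl := Num.min e 1.
have dl0 : 0 < dl by rewrite lt_min e0 ltr01.
have [a [b [[al bl] aN bN a0 ab]]] :=
  gamma2_coordinates x c0 dl0 (phiG t) (phic t).
pose w (j : J) : R := let: (s, i, n, r) := j in
  let v := if s then a (x i) n else b (y i) n in
  if r then complex.Re v else complex.Im v.
have zE s i n : z w s i n = if s then a (x i) n else b (y i) n.
  by rewrite /z /=; case: (if s then _ else _).
have one_le (h : nat -> C) (m : R) n :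
    (forall N, \sum_(0 <= k < N) cabs (h k) ^+ 2 <= m ^+ 2) ->
    0 <= m -> cabs (h n) <= m.
  move=> H m0; rewrite -(@ler_pXn2r _ 2)// ?nnegrE ?cabs_ge0//.
  apply: le_trans (H n.+1); rewrite big_nat_recr//= lerDr.
  by apply: sumr_ge0 => k _; exact: sqr_ge0.
have ReIm (v : C) (r : bool) : `|if r then complex.Re v else complex.Im v| <= cabs v.
  by case: r; [exact: Re_le_cabs|exact: Im_le_cabs].
exists w.
  case=> [[[[] i] n] r] /=.
    apply: le_trans (ReIm _ _) _.
    case: leqP => ni; last by rewrite a0 ?cabs0.
    by apply: one_le (nrm_ge0 _) => N; exact: aN.
  apply: le_trans (ReIm _ _) _; apply: one_le => [N|].
    2: by rewrite mulr_ge0 ?sqrtr_ge0 ?nrm_ge0.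
  apply: le_trans (bN _ _) _.
  rewrite exprMn sqr_sqrtr ?addr_ge0 ?sqr_ge0// ler_wpM2r ?sqr_ge0//.
  by rewrite lerD2l ge_min lexx orbT.
have linB (V : normedModType C) (h : V -> nat -> C) :
    (forall s u v n, h (s *: u + v) n = s * h u n + h v n) ->
    forall s u v v' n, h (s *: u + v - v') n = s * h u n + h v n - h v' n.
  move=> hl s u v v' n.
  by rewrite [s *: u + v - v']addrC -scaleN1r !hl mulN1r addrC.
have kapN s p i j k N : \sum_(0 <= n < N) cabs (comb (z w s) p i j k n) ^+ 2 <=
    (kap s + dl) * nv s p i j k ^+ 2.
  case: s; rewrite /kap /nv.
    apply: (@le_trans _ _ (nrm (ratC R p *: x i + x j - x k) ^+ 2)).
      apply: le_trans (aN _ N); rewrite le_eqVlt; apply/orP; left; apply/eqP.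
      by apply: eq_bigr => n _; rewrite /comb !zE (linB _ a).
    by rewrite ler_peMl ?sqr_ge0// lerDl ltW.
  apply: le_trans (bN _ N); rewrite le_eqVlt; apply/orP; left; apply/eqP.
  by apply: eq_bigr => n _; rewrite /comb !zE (linB _ b).
have dle : dl <= e by rewrite ge_min lexx.
case=> [[[[s p] [[i j] k]] N]|[i j]] /=; last first.
  by rewrite ab; under [X in _ - X]eq_bigr do rewrite !zE; rewrite subrr cabs0 ltW.
have n0 := sqr_ge0 (nv s p i j k).
rewrite ler_pdivrMr; last by rewrite ltr_wpDr.
rewrite lerBlDr; apply: le_trans (kapN _ _ _ _ _ _) _.
have : dl * nv s p i j k ^+ 2 <= e * nv s p i j k ^+ 2 by rewrite ler_wpM2r.
by rewrite mulrDl mulrDr mulr1; lra.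
Qed.

(** The arrays encoding a factorization of phi t are the solutions of countably
    many conditions, each continuous in finitely many bounded unknowns.  By
    [gamma2_coordinates] they can be solved approximately for each t, hence
    exactly and measurably by [measurable_selection]; so the infimum defining
    gamma2 is attained, with a measurable choice. *)
Lemma measurable_factorization : exists a b : nat -> nat -> T -> C,
  [/\ (forall i n, measurable_C (a i n)) /\ (forall i n, measurable_C (b i n)),
      forall t p i j k N,
        \sum_(0 <= n < N) cabs (ratC R p * a i n t + a j n t - a k n t) ^+ 2
        <= nrm (ratC R p *: x i + x j - x k) ^+ 2,
      forall t p i j k N,
        \sum_(0 <= n < N) cabs (ratC R p * b i n t + b j n t - b k n t) ^+ 2
        <= (c * nrm (ratC R p *: y i + y j - y k)) ^+ 2,
      forall t i n, (i < n)%N -> a i n t = 0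
    & forall t i j, phi t (x i) (y j) = \sum_(0 <= n < i.+1) a i n t * b j n t].
Proof.
have [w [wm wB wg]] := measurable_selection B_ge0 g_cont g_meas g_approx.
pose W t j := w j t.
have gle s p i j k N t : \sum_(0 <= n < N) cabs (comb (z (W t) s) p i j k n) ^+ 2 <=
    kap s * nv s p i j k ^+ 2.
  have := wg (inl (s, p, (i, j, k), N)) t; rewrite /= ler_pdivrMr ?mul0r ?subr_le0//.
  by rewrite ltr_wpDr ?sqr_ge0.
exists (fun i n t => z (W t) true i n), (fun i n t => z (W t) false i n); split.
- by split=> i n; split; exact: wm.
- by move=> t p i j k N; rewrite -[leRHS]mul1r; exact: gle.
- by move=> t p i j k N; rewrite exprMn; exact: gle.
- move=> t i n ltin; apply/eqP; rewrite -cabs_eq0 eq_le cabs_ge0 andbT.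
  apply: le_trans (cabs_le _) _; rewrite /z /=.
  have := wB (true, i, n, true) t; have := wB (true, i, n, false) t.
  by rewrite /B leqNgt ltin /= /W; lra.
- move=> t i j; apply/eqP; rewrite -subr_eq0 -cabs_eq0 eq_le cabs_ge0 andbT.
  exact: (wg (inr (i, j)) t).
Qed.

End MeasurableFactorization.

(** * Bounded measurable families of operators into l2 *)

Section BopTopology.
Variable R : realType.
Local Notation C := (R[i]).
Variables (V W : normedModType C).

Lemma bopB (f : bop V W) (u v : V) : f (u - v) = f u - f v.
Proof. by rewrite -scaleN1r addrC bop_linear scaleN1r addrC. Qed.

Lemma bop_cvg {I : Type} (F : set_system I) {FF : Filter F} (f : bop V W)
    (u : I -> V) l :
  u @ F --> l -> (fun i => f (u i)) @ F --> f l.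
Proof.
move=> /cvg_nrmP ul; apply/cvg_nrmP => e e0.
have f0 : 0 < opnorm f + 1 by rewrite ltr_wpDl ?opnorm_ge0.
apply: filterS (ul _ (divr_gt0 e0 f0)) => i; rewrite ltr_pdivlMr// => H.
rewrite -bopB; apply: le_lt_trans (le_opnorm f _) _; apply: le_lt_trans H.
by rewrite mulrC ler_wpM2l ?nrm_ge0// lerDl.
Qed.

(** The duality between B(V, W) and the projective tensor product of V and the
    dual of W, on elementary tensors. *)
Definition eval_form (u : bop V W) (x : V) (k : dual W) : C^o := k (u x).

Fact eval_form_bilinear u : bilinear_for *:%R *:%R (eval_form u).
Proof.
split=> [k a x y|x a k l]; first by rewrite /eval_form !bop_linear.
by [].
Qed.

HB.instance Definition _ u := bilinear_isBilinear.Build C V (dual W) C^o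
  *:%R *:%R (eval_form u) (eval_form_bilinear u).

Lemma tensor_eval_sub (b : V -> dual W -> C^o) s s' : 
  (forall x k, b (- x) k = - b x k) ->
  tensor_eval b (tensor_sub s s') = tensor_eval b s - tensor_eval b s'.
Proof.
move=> bN; rewrite /tensor_eval /tensor_sub big_cat big_map -sumrN.
by congr (_ + _); apply: eq_bigr => p _; rewrite bN.
Qed.

(** The value at s depends only on the tensor that s represents, so it can be
    estimated on a representative that nearly attains the projective norm. *)
Lemma tensor_eval_projective (u : bop V W) s (e : R) : projective_norm s < e ->
  cabs (tensor_eval (eval_form u) s) <= opnorm u * e.
Proof.
move=> /inf_lt[|r [s' ss' ->] se].
  by exists (\sum_(p <- s) nrm p.1 * nrm p.2), s.
rewrite (ss' C^o (eval_form u)).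
apply: (@le_trans _ _ (opnorm u * \sum_(p <- s') nrm p.1 * nrm p.2)); last first.
  by rewrite ler_wpM2l ?opnorm_ge0// ltW.
rewrite /tensor_eval mulr_sumr; elim: s' {ss' se} => [|p s' IH].
  by rewrite !big_nil cabs0.
rewrite !big_cons (le_trans (cabsD _ _))// lerD// /eval_form.
apply: le_trans (le_opnorm p.2 _) _.
by rewrite mulrC mulrA ler_wpM2r ?opnorm_ge0//; exact: (le_opnorm u).
Qed.

Lemma eval_form_cauchy_cvg (u : bop V W) (z : nat -> seq (V * dual W)) :
  tensor_cauchy (@projective_norm R V (dual W)) z ->
  cvgn (fun n => tensor_eval (eval_form u) (z n)).
Proof.
move=> cz; apply: C_cauchy_cvg => e e0.
have u0 : 0 < opnorm u + 1 by rewrite ltr_wpDl ?opnorm_ge0.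
have [n0 H] := cz _ (divr_gt0 e0 u0); exists n0 => m n m0 nn0.
have := tensor_eval_projective u (H m n m0 nn0).
rewrite tensor_eval_sub => [|x k]; last first.
  by rewrite /eval_form -scaleN1r bopZ bopZ scaleN1r.
move=> /le_lt_trans; apply; rewrite mulrCA gtr_pMr// ltr_pdivrMr// mul1r.
by rewrite ltrDl.
Qed.

End BopTopology.

Section LinftyB.
Context (R : realType) (d : measure_display) (T : measurableType d).
Variable mu : {measure set T -> \bar R}.
Local Notation C := (R[i]).

Lemma Linfty_norm_le (f : T -> R) (M : R) : 0 <= M -> (forall t, `|f t| <= M) ->
  (Linfty_norm mu f <= M%:E)%E.
Proof.
move=> M0 fM; rewrite /Linfty_norm unlock; case: ifPn => _; last by rewrite lee_fin.
by apply/ess_supP; apply: nearW => t /=; rewrite lee_fin.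
Qed.

Lemma bounded_Lfun_oo (f : T -> R) (M : R) : measurable_fun setT f ->
  (forall t, `|f t| <= M) -> f \in Lfun mu +oo.
Proof.
move=> mf fM; rewrite inE; apply/andP; split; rewrite inE//=.
rewrite /finite_norm; apply: (@le_lt_trans _ _ (`|M|)%:E); last by rewrite ltry.
by apply: Linfty_norm_le => // t; exact: le_trans (ler_norm _).
Qed.

Variables (E : normedModType C) (x : nat -> E) (alpha : T -> bop E (l2H R)) (M : R).
Hypothesis x_dense : forall v (e : R), 0 < e -> exists i, nrm (v - x i) < e.
Hypothesis M0 : 0 <= M.
Hypothesis alphaM : forall t v, nrm (alpha t v) <= M * nrm v.
Hypothesis alpha_meas : forall i n,
  measurable_C (fun t => (alpha t (x i) : l2 R) n).

Let alpha_coord v n : measurable_C (fun t => (alpha t v : l2 R) n).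
Proof.
have /choice[s sP] : forall m : nat, exists i, nrm (v - x i) < m.+1%:R^-1.
  by move=> m; apply: x_dense; rewrite invr_gt0.
have xs : (fun m => x (s m)) @ \oo --> v.
  apply/cvg_nrmP => e e0; near=> m; apply: lt_trans (sP m) _.
  by near: m; exact: inv_nat_lt.
apply: (@measurable_C_cvg _ _ _ (fun m t => (alpha t (x (s m)) : l2 R) n)) => // t.
have /cvg_nrmP H : (fun m => alpha t (x (s m))) @ \oo --> alpha t v.
  exact: bop_cvg.
apply/cvg_nrmP => e /H.
apply: filterS => m; apply: le_lt_trans.
exact: (cabs_le_nrm (alpha t v - alpha t (x (s m)) : l2 R)).
Unshelve. all: by end_near. Qed.

Let alpha_functional v (k : dual (l2H R)) :
  measurable_C (fun t => k (alpha t v) : C).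
Proof.
apply: (@measurable_C_cvg _ _ _ (fun N t =>
  \sum_(0 <= n < N) (alpha t v : l2 R) n * k (l2unit R n))) => [N|t].
  by apply: measurable_C_sum => n; apply: measurable_CM => //; exact: measurable_C_cst.
rewrite (_ : (fun N => _) = (fun N => k (l2trunc (alpha t v : l2 R) N))).
  by apply: bop_cvg; exact: l2trunc_cvg.
apply/funext => N; rewrite -l2_sum_unit.
elim: N => [|N IH]; first by rewrite !big_geq// bop0.
by rewrite !big_nat_recr//= bopD bopZ IH.
Qed.

Lemma opnorm_bound t : `|nrm (alpha t)| <= M.
Proof.
rewrite ger0_norm ?nrm_ge0//; apply: ge_sup.
  by exists (nrm (alpha t 0)), 0 => //; rewrite nrm0.
move=> _ [v v1 ->]; apply: le_trans (alphaM t v) _.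
by rewrite -[leRHS]mulr1 ler_wpM2l.
Qed.

Let alpha_nrm i : measurable_fun setT (fun t => nrm (alpha t (x i))).
Proof.
rewrite (_ : (fun t => _) =
  (fun t => Num.sqrt (limn (sqsum (alpha t (x i) : l2 R)))))//.
apply: measurable_fun_sqrt.
apply: (@measurable_fun_cvg _ _ _ _ (fun N t => sqsum (alpha t (x i) : l2 R) N)).
  move=> N; rewrite /sqsum.
  have H (r : seq nat) : measurable_fun setT
      (fun t => \sum_(n <- r) cabs ((alpha t (x i) : l2 R) n) ^+ 2).
    elim: r => [|n r IH].
      rewrite (_ : (fun t => _) = cst 0); first exact: measurable_cst.
      by apply/funext => t; rewrite big_nil.
    rewrite (_ : (fun t => _) =
       (fun t => cabs ((alpha t (x i) : l2 R) n) ^+ 2) \+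
       (fun t => \sum_(n <- r) cabs ((alpha t (x i) : l2 R) n) ^+ 2)).
      by apply: measurable_funD => //; exact: measurable_sqr_cabs.
    by apply/funext => t; rewrite big_cons.
  exact: H.
by move=> t _; exact: sqsum_cvg.
Qed.

(** By density, the operator norm is the supremum of the countably many quotients
    |alpha t (x i)| / |x i|. *)
Lemma measurable_opnorm : measurable_fun setT (fun t => nrm (alpha t)).
Proof.
pose h i t := nrm (alpha t (x i)) / nrm (x i).
have h_le i t : h i t <= nrm (alpha t).
  rewrite /h; have [->|xi0] := eqVneq (nrm (x i)) 0.
    by rewrite invr0 mulr0 nrm_ge0.
  by rewrite ler_pdivrMr ?lt_def ?xi0 ?nrm_ge0//; exact: le_opnorm.
have hub t : has_ubound (range (h ^~ t)).
  by exists (nrm (alpha t)) => _ [i _ <-].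
rewrite (_ : (fun t => _) = (fun t => sups (h ^~ t) 0)).
  apply: measurable_fun_sups => [t _|i]; first exact: hub.
  by apply: measurable_funM => //; exact: measurable_cst.
apply/funext => t.
have -> : sups (h ^~ t) 0 = sup (range (h ^~ t)).
  by congr sup; apply/seteqP; split=> r [i _ <-]; exists i.
apply/eqP; rewrite eq_le; apply/andP; split; last first.
  by apply: ge_sup; [exists (h 0 t), 0%N|move=> _ [i _ <-]].
set s := sup _.
have hs i : h i t <= s by apply: ub_le_sup => //; exists i.
have s0 : 0 <= s by apply: le_trans (hs 0%N); rewrite /h divr_ge0 ?nrm_ge0.
have xs i : nrm (alpha t (x i)) <= s * nrm (x i).
  have [x0|xi0] := eqVneq (nrm (x i)) 0.
    by apply: le_trans (alphaM _ _) _; rewrite x0 !mulr0.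
  by have := hs i; rewrite /h ler_pdivrMr// lt_def xi0 nrm_ge0.
apply: ge_sup; first by exists (nrm (alpha t 0)), 0 => //; rewrite nrm0.
move=> _ [v v1 ->]; apply/ler_addgt0Pr => e e0.
have MM : 0 < M + s + 1 by rewrite ltr_wpDl ?addr_ge0.
have [i vi] := x_dense v (divr_gt0 e0 MM).
rewrite ltr_pdivlMr// in vi.
have h1 := nrmD (alpha t (x i)) (alpha t (v - x i)).
rewrite -bopD addrC subrK in h1; apply: (le_trans h1).
have h2 := alphaM t (v - x i).
have h3 : nrm (x i) <= 1 + nrm (v - x i).
  have := nrmD v (x i - v); rewrite addrC subrK nrmB => /le_trans; apply.
  by rewrite lerD2r.
have h4 := ler_wpM2l s0 h3.
have := xs i; have := nrm_ge0 (v - x i); lra.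
Qed.

(** Measurability of the coordinates of alpha t (x i) passes to alpha t v, then to
    k (alpha t v) for a functional k, to tensors, and to limits of Cauchy
    sequences of tensors. *)
Lemma Linfty_sigma_BP : Linfty_sigma_B mu alpha.
Proof.
split; last exact: bounded_Lfun_oo measurable_opnorm opnorm_bound.
move=> z cz.
apply: (@measurable_C_cvg _ _ _
  (fun n t => tensor_eval (eval_form (alpha t)) (z n))) => [n|t].
  exact: (measurable_C_sum (z n) (fun p => alpha_functional p.1 p.2)).
exact: eval_form_cauchy_cvg.
Qed.

End LinftyB.

(** * From arrays to operators *)

Section Assembly.
Variable R : realType.
Local Notation C := (R[i]).

Lemma coordinates_extension (V : normedModType C) (x : nat -> V) (M : R)
    (a : nat -> nat -> C) :
  (forall v (e : R), 0 < e -> exists i, nrm (v - x i) < e) -> 0 <= M ->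
  (forall p i j k N,
     \sum_(0 <= n < N) cabs (ratC R p * a i n + a j n - a k n) ^+ 2
     <= (M * nrm (ratC R p *: x i + x j - x k)) ^+ 2) ->
  exists f : bop V (l2H R), (forall i n, (f (x i) : l2 R) n = a i n) /\
    (forall v, nrm (f v) <= M * nrm v).
Proof.
move=> x_dense M0 aM.
have a_l2 i : sqsummable_pred (a i).
  apply/asboolP; exists ((M * nrm (ratC R (1, 0) *: x i + x i - x i)) ^+ 2) => N.
  have r1 : ratC R (1, 0) = 1 by rewrite /ratC /= rmorph0 rmorph1.
  apply: le_trans (aM (1, 0) i i i N); rewrite r1 le_eqVlt; apply/orP; left; apply/eqP.
  by apply: eq_bigr => n _; rewrite mul1r addrK.
have [|f [fx fM]] := @dense_extension R V (l2H R) x (fun i => L2 (a_l2 i)) M x_dense M0.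
  move=> p i j k; apply: nrm_le_sqsum => [|N]; first by rewrite mulr_ge0 ?nrm_ge0.
  exact: aM.
by exists f; split=> // i n; rewrite fx.
Qed.

Lemma additive_dense_eq0 (V : normedModType C) (x : nat -> V) (f : V -> C) (M : R) :
  (forall v (e : R), 0 < e -> exists i, nrm (v - x i) < e) ->
  (forall u v, f (u - v) = f u - f v) -> (forall v, cabs (f v) <= M * nrm v) ->
  (forall i, f (x i) = 0) -> forall v, f v = 0.
Proof.
move=> x_dense fB fM fx v; apply/eqP; rewrite -cabs_eq0 eq_le cabs_ge0 andbT.
apply/ler_addgt0Pr => e e0; rewrite add0r.
have M1 : 0 < `|M| + 1 by rewrite ltr_wpDl.
have [i vi] := x_dense v _ (divr_gt0 e0 M1).
have := fM (v - x i); rewrite fB fx subr0 => /le_trans; apply.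
rewrite ltr_pdivlMr// in vi; apply: le_trans (ltW vi).
by rewrite mulrC ler_wpM2l ?nrm_ge0// (le_trans (ler_norm _))// lerDl.
Qed.

Lemma Gamma2_0 (E F : normedModType C) : Gamma2 (0 : bop E F).
Proof.
exists (nrm (0 : bop E (l2H R)) * nrm (0 : bop (l2H R) F)).
by exists (l2H R), 0, 0.
Qed.

Lemma gamma2_0 (E F : normedModType C) : gamma2 (0 : bop E F) = 0.
Proof.
apply/eqP; rewrite eq_le; apply/andP; split.
  apply: ge_inf; last by exists (l2H R), 0, 0; rewrite !nrm0 mulr0.
  by exists 0 => _ [K [a [b [_ ->]]]]; rewrite mulr_ge0 ?nrm_ge0.
apply: lb_le_inf; first exact: Gamma2_0.
by move=> _ [K [a [b [_ ->]]]]; rewrite mulr_ge0 ?nrm_ge0.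
Qed.

(** An elementary tensor is the limit of a constant sequence. *)
Lemma wstar_measurable_eval (d : measure_display) (T : measurableType d)
    (E F : normedModType C) (phi : T -> bop E (dual F)) (x : E) (y : F) :
  wstar_measurable (@gamma2_dual_norm R E F)
    (fun (u : bop E (dual F)) x y => u x y) phi ->
  measurable_C (fun t => phi t x y).
Proof.
move=> /(_ (fun _ => [:: (x, y)])) H.
rewrite (_ : (fun t => _) = fun t =>
    limn (fun _ : nat => tensor_eval (fun x y => phi t x y : C^o) [:: (x, y)])).
  apply: H => e e0; exists 0%N => m n _ _.
  rewrite /gamma2_dual_norm; apply: le_lt_trans e0.
  apply: ge_sup; last first.
    move=> _ [u _ ->]; rewrite /tensor_eval /tensor_sub big_cat /= !big_seq1 /=.
    have -> : u (- x) = - u x by rewrite -scaleN1r bopZ scaleN1r.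
    rewrite -/(cabs _); have -> : (- u x) y = - u x y by [].
    by rewrite le_eqVlt; apply/orP; left; rewrite subrr; apply/eqP; exact: cabs0.
  exists 0; exists 0; last first.
    by rewrite /tensor_eval big1 => [|p _ //]; exact/esym/cabs0.
  by split; [exact: Gamma2_0|rewrite gamma2_0 ler01].
apply/funext => t; rewrite lim_cst; last exact: norm_hausdorff.
by rewrite /tensor_eval big_seq1.
Qed.

Lemma l2dot_le (f g : l2 R) : cabs (l2dot f g) <= nrm f * nrm g.
Proof.
rewrite -(@ler_pXn2r _ 2)// ?nnegrE ?mulr_ge0 ?nrm_ge0 ?cabs_ge0// exprMn.
by have := dot_cauchy_schwarz (@l2dot R) f g; rewrite !Re_l2dot.
Qed.

Lemma l2conjB (f g : l2 R) : l2conj (f - g) = l2conj f - l2conj g.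
Proof. by apply: l2P => n; exact: rmorphB. Qed.

(** On the dense sequences the series defining the pairing stops at the index i,
    by triangularity; both sides are additive and bounded in each variable. *)
Lemma pairing_eq (E F : normedModType C) (x : nat -> E) (y : nat -> F)
    (u : bop E (dual F)) (al : bop E (l2H R)) (be : bop F (l2H R)) :
  (forall v (e : R), 0 < e -> exists i, nrm (v - x i) < e) ->
  (forall v (e : R), 0 < e -> exists i, nrm (v - y i) < e) ->
  (forall i n, (i < n)%N -> (al (x i) : l2 R) n = 0) ->
  (forall i j, u (x i) (y j) =
     \sum_(0 <= n < i.+1) (al (x i) : l2 R) n * (be (y j) : l2 R) n) ->
  forall v w, u v w = bilinear_pairing setT (l2unit R : nat -> l2H R) (al v) (be w).
Proof.
move=> x_dense y_dense al0 uE v w; rewrite bilinear_pairingE.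
apply/eqP; rewrite -subr_eq0; apply/eqP; move: w.
have dotE i j : u (x i) (y j) = l2dot (al (x i)) (l2conj (be (y j))).
  rewrite uE; apply/esym/l2dot_lim/cvg_nrmP => e e0; exists i.+1 => // N /= iN.
  rewrite (_ : \sum_(0 <= n < N) _ =
      \sum_(0 <= n < i.+1) (al (x i) : l2 R) n * (be (y j) : l2 R) n).
    by rewrite subrr nrm0.
  rewrite (big_cat_nat (n := i.+1))//= [X in _ + X]big_nat.
  rewrite [X in _ + X]big1 ?addr0 => [|n /andP[ltin _]]; last first.
    by rewrite al0 ?mul0r.
  by apply: eq_bigr => n _; rewrite conjCK.
have vj j : u v (y j) - l2dot (al v) (l2conj (be (y j))) = 0.
  move: v; apply: (additive_dense_eq0
    (M := opnorm u * nrm (y j) + opnorm al * nrm (l2conj (be (y j)))) x_dense).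
  - move=> v1 v2; rewrite !bopB (dotBl (@l2dot R)).
    rewrite (_ : bop_fun _ (y j) = u v1 (y j) - u v2 (y j))//.
    by rewrite opprD addrACA -opprD.
  - move=> v1; apply: le_trans (cabsD _ _) _; rewrite cabsN mulrDl lerD//.
      apply: (le_trans (le_opnorm (u v1) _)).
      by rewrite mulrAC ler_wpM2r ?nrm_ge0//; exact: (le_opnorm u v1).
    apply: (le_trans (l2dot_le _ _)).
    by rewrite mulrAC ler_wpM2r ?nrm_ge0//; exact: (le_opnorm al v1).
  - by move=> i; rewrite dotE subrr.
apply: (additive_dense_eq0
    (M := opnorm (u v) + nrm (al v) * opnorm be) y_dense).
- by move=> w1 w2; rewrite !bopB l2conjB (dotBr (@l2dot R)) opprD addrACA -opprD.
- move=> w1; apply: le_trans (cabsD _ _) _; rewrite cabsN mulrDl lerD//.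
    exact: (le_opnorm (u v)).
  apply: (le_trans (l2dot_le _ _)).
  by rewrite -mulrA ler_wpM2l ?nrm_ge0// nrm_l2conj; exact: (le_opnorm be w1).
- exact: vj.
Qed.

End Assembly.

Theorem theorem15 (R : realType) (d : measure_display) (T : measurableType d)
    (mu : {measure set T -> \bar R}) (hmu : separable_measure mu)
    (E F : completeNormedModType R[i]) (hE : separable E) (hF : separable F)
    (phi : T -> bop E (dual F)) (hphi : Linfty_sigma_Gamma2 mu phi) :
  exists (H : hilbertType R) (D : set nat) (e : nat -> H)
      (alpha : T -> bop E H) (beta : T -> bop F H),
    [/\ separable H,
        orthonormal_basis D e,
        Linfty_sigma_B mu alpha /\ Linfty_sigma_B mu beta,
        (Linfty_norm mu (fun t => nrm (alpha t)) *
           Linfty_norm mu (fun t => nrm (beta t))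
         <= Linfty_norm mu (fun t => gamma2 (phi t)))%E
      & forall (x : E) (y : F), \forall t \ae mu,
          phi t x y = bilinear_pairing D e (alpha t x) (beta t y)].
Proof.
have [phiG phi_wstar phi_Lfun] := hphi.
have [x x_dense] := separable_dense_seq hE.
have [y y_dense] := separable_dense_seq hF.
have gm : measurable_fun setT (fun t => gamma2 (phi t)).
  by move: phi_Lfun; rewrite inE => /andP[+ _]; rewrite inE.
have gfin : (Linfty_norm mu (fun t => gamma2 (phi t)) < +oo)%E.
  by move: phi_Lfun; rewrite inE => /andP[_]; rewrite inE.
have g0 : (0 <= Linfty_norm mu (fun t => gamma2 (phi t)))%E by exact: Lnorm_ge0.
pose c := fine (Linfty_norm mu (fun t => gamma2 (phi t))).
have cE : Linfty_norm mu (fun t => gamma2 (phi t)) = c%:E.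
  by rewrite fineK// ge0_fin_numE.
have c0 : 0 <= c by rewrite fine_ge0.
have gae : \forall t \ae mu, gamma2 (phi t) <= c.
  move: cE; rewrite /Linfty_norm unlock; case: ifPn => [_ cE|mu0 _].
    pose g t := `|(gamma2 (phi t))%:E|%E.
    apply: filterS (ess_sup_ge mu g) => t; rewrite /g /=.
    by rewrite cE lee_fin; exact: le_trans (ler_norm _).
  exists setT; split => //; apply/eqP; move: mu0.
  by rewrite lt_def measure_ge0 andbT negbK.
(* setting phi to 0 on a null set gives the bound c everywhere *)
pose psi t : bop E (dual F) := if gamma2 (phi t) <= c then phi t else 0.
have psiG t : Gamma2 (psi t) by rewrite /psi; case: ifP => // _; exact: Gamma2_0.
have psic t : gamma2 (psi t) <= c.
  by rewrite /psi; case: ifP => // _; rewrite gamma2_0.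
have psim i j : measurable_C (fun t => psi t (x i) (y j)).
  rewrite (_ : (fun t => _) = (fun t =>
      (\1_[set t | gamma2 (phi t) <= c] t)%:C%C * phi t (x i) (y j))).
    apply: measurable_CM; last exact: wstar_measurable_eval.
    split; last exact: measurable_cst.
    apply: measurable_indic; rewrite -[X in measurable X]setTI.
    rewrite (_ : [set t | _] = (fun t => gamma2 (phi t)) @^-1` `]-oo, c])//.
    exact: gm.
  apply/funext => t; rewrite /psi indicE; case: ifPn => tc.
    by rewrite mem_set// rmorph1 mul1r.
  by rewrite memNset ?rmorph0 ?mul0r//=; exact/negP.
have [a [b [[am bm] aN bN a0 ab]]] := measurable_factorization c0 psiG psic psim.
have /choice[alpha alphaP] : forall t, exists f : bop E (l2H R),
    (forall i n, (f (x i) : l2 R) n = a i n t) /\ (forall v, nrm (f v) <= 1 * nrm v).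
  move=> t.
  apply: (@coordinates_extension _ _ _ _ (fun i n => a i n t)) => // p i j k N.
  by rewrite mul1r; exact: aN.
have /choice[beta betaP] : forall t, exists f : bop F (l2H R),
    (forall i n, (f (y i) : l2 R) n = b i n t) /\ (forall v, nrm (f v) <= c * nrm v).
  by move=> t; apply: (@coordinates_extension _ _ _ _ (fun i n => b i n t)).
have alM t v := (alphaP t).2 v.
have beM t v := (betaP t).2 v.
have alm i n : measurable_C (fun t => (alpha t (x i) : l2 R) n).
  by rewrite (_ : (fun t => _) = a i n)//; apply/funext => t; rewrite (alphaP t).1.
have bem i n : measurable_C (fun t => (beta t (y i) : l2 R) n).
  by rewrite (_ : (fun t => _) = b i n)//; apply/funext => t; rewrite (betaP t).1.
exists (l2H R), setT, (l2unit R), alpha, beta; split.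
- exact: l2_separable.
- exact: l2_orthonormal_basis.
- by split; [exact: Linfty_sigma_BP x_dense ler01 alM alm|
             exact: Linfty_sigma_BP y_dense c0 beM bem].
- rewrite cE -(mul1e c%:E).
  apply: lee_pmul; [exact: Lnorm_ge0|exact: Lnorm_ge0| |].
    by apply: Linfty_norm_le => // t; exact: opnorm_bound.
  by apply: Linfty_norm_le => // t; exact: opnorm_bound.
- move=> v w; apply: filterS gae => t tc.
  have <- : psi t = phi t by rewrite /psi tc.
  apply: (pairing_eq x_dense y_dense) => [i n ltin|i j].
    by rewrite (alphaP t).1 a0.
  by rewrite ab; apply: eq_bigr => n _; rewrite (alphaP t).1 (betaP t).1.
Qed.
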